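(* Let $n\ge 1$, let $f_0,\dots,f_n$ be entire functions that are real valued on $\mathbb{R}$, and let $\eta_0,\dots,\eta_n$ be real valued i.i.d. random variables with $\mathbb{E}[\eta_k]=0$, $\mathbb{E}[\eta_k^2]=1$, whose common characteristic function $\phi(s)=\mathbb{E}[e^{is\eta_0}]$ satisfies: for fixed $a>0$ and $q\ge 1$, $$|\phi(s)|\le\frac{1}{(1+as^2)^q}\quad (s\in\mathbb{R}),$$ and $\phi$ is three times differentiable with constants $C_2,C_3>0$ such that $$\sup_{s\in\mathbb{R}}\Big|\frac{d^j\phi(s)}{ds^j}\Big|\le C_j,\qquad j=2,3.$$ Let $P_n(z)=\sum_{k=0}^n\eta_kf_k(z)$ and let $\rho_n(x)$ be the density function for the expected number of real zeros of $P_n$. Then $$\rho_n(x)\le \mathcal K_n(x)\,\frac{1}{aq}\Big[k_1+C_3k_2+\frac{1}{\sqrt{aq}}\,C_2\,(k_3+C_2k_4)\Big],$$ where $\mathcal K_n(x)=\dfrac{\sqrt{K_n^{(1,1)}(x,x)K_n(x,x)-(K_n^{(0,1)}(x,x))^2}}{K_n(x,x)}$ with $K_n(x,x)=\sum_{j=0}^nf_j(x)^2$, $K_n^{(0,1)}(x,x)=\sum_{j=0}^nf_j(x)f_j'(x)$, $K_n^{(1,1)}(x,x)=\sum_{j=0}^nf_j'(x)^2$, and where $k_1,k_2,k_3,k_4$ are the constants $$k_1=\tfrac{1}{\pi}\Big(1-\log 2+\tfrac{\pi\sqrt3+\log 8}{9}\Big)\approx 0.36,\quad k_2=\tfrac{1}{9\pi}(\pi\sqrt3+\log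 8)\approx 0.27,$$ $$k_3=\tfrac{1}{\sqrt2}(1-\log 2)\approx 0.21,\quad k_4=\tfrac{\sqrt2}{9}(\pi\sqrt3+\log 8)\approx 1.18.$$
   Context: The density $\rho_n$ is the Kac–Rice intensity: $\rho_n(x)=\int_{\mathbb{R}}|\eta|\,D_n(0,\eta;x)\,d\eta$, where $D_n(\xi,\eta;x)$ is the joint distribution density of $(P_n(x),P_n'(x))$, so that the expected number of real zeros of $P_n$ in a measurable $\Omega\subset\mathbb{R}$ equals $\int_\Omega\rho_n(x)\,dx$. The bound is asserted at points $x$ where $K_n(x,x)>0$ and $K_n^{(1,1)}(x,x)K_n(x,x)-K_n^{(0,1)}(x,x)^2>0$. *)

(* Defs.v *)
From HB Require Import structures.
From mathcomp Require Import all_boot all_order all_algebra.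
From mathcomp Require Import all_classical all_reals all_analysis.
Set Implicit Arguments. Unset Strict Implicit. Unset Printing Implicit Defensive.
Import Order.TTheory GRing.Theory Num.Theory numFieldNormedType.Exports.
Local Open Scope classical_set_scope.
Local Open Scope ring_scope.

(* An entire function that is real valued on the real line, represented by its
   restriction to R: it is the sum of a power series with real coefficients
   whose radius of convergence is infinite (absolute convergence at every
   radius |x|). *)
Definition entire_real (R : realType) (f : R -> R) : Prop :=
  exists c : nat -> R,
    (forall x : R, cvgn (series (fun k => `|c k| * `|x| ^+ k))) /\
    (forall x : R, f x = limn (series (fun k => c k * x ^+ k))).

Definition mutually_independent d (T : measurableType d) (R : realType)
  (P : probability T R) (m : nat) (X : 'I_m -> T -> R) : Prop :=
  forall B : 'I_m -> set R, (forall i, measurable (B i)) ->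
    P (\bigcap_(i in [set: 'I_m]) (X i @^-1` B i)) =
    (\big[*%E/1%E]_(i < m) P (X i @^-1` B i))%E.

Definition identically_distributed d (T : measurableType d) (R : realType)
  (P : probability T R) (m : nat) (X : 'I_m.+1 -> T -> R) : Prop :=
  forall (i : 'I_m.+1) (B : set R), measurable B ->
    P (X i @^-1` B) = P (X ord0 @^-1` B).

(* Real and imaginary parts of the characteristic function
   phi(s) = E[exp(i s X)] = E[cos(s X)] + i E[sin(s X)]. *)
Definition charRe d (T : measurableType d) (R : realType)
  (P : probability T R) (X : T -> R) (s : R) : R :=
  fine ('E_P[fun w => cos (s * X w)])%E.
Definition charIm d (T : measurableType d) (R : realType)
  (P : probability T R) (X : T -> R) (s : R) : R :=
  fine ('E_P[fun w => sin (s * X w)])%E.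

Definition cmod (R : realType) (u v : R) : R := Num.sqrt (u ^+ 2 + v ^+ 2).

Definition Pn d (T : measurableType d) (R : realType) (P : probability T R)
  (n : nat) (eta : 'I_n.+1 -> {RV P >-> R}) (f : 'I_n.+1 -> R -> R) (x : R) : T -> R :=
  fun w => \sum_(k < n.+1) eta k w * f k x.
Definition dPn d (T : measurableType d) (R : realType) (P : probability T R)
  (n : nat) (eta : 'I_n.+1 -> {RV P >-> R}) (f : 'I_n.+1 -> R -> R) (x : R) : T -> R :=
  fun w => \sum_(k < n.+1) eta k w * derive1 (f k) x.

Definition is_joint_density d (T : measurableType d) (R : realType)
  (P : probability T R) (X Y : T -> R) (D : R -> R -> R) : Prop :=
  forall A : set (R * R), measurable A ->
    P ((fun w => (X w, Y w)) @^-1` A) =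
    (\int[(@lebesgue_measure R) \x (@lebesgue_measure R)]_(p in A) (D p.1 p.2)%:E)%E.

Definition kac_rice (R : realType) (D : R -> R -> R) : \bar R :=
  (\int[@lebesgue_measure R]_(y in [set: R]) (`|y| * D 0 y)%:E)%E.

Definition Kn (R : realType) (n : nat) (f : 'I_n.+1 -> R -> R) (x : R) : R :=
  \sum_(j < n.+1) f j x ^+ 2.
Definition Kn01 (R : realType) (n : nat) (f : 'I_n.+1 -> R -> R) (x : R) : R :=
  \sum_(j < n.+1) f j x * derive1 (f j) x.
Definition Kn11 (R : realType) (n : nat) (f : 'I_n.+1 -> R -> R) (x : R) : R :=
  \sum_(j < n.+1) derive1 (f j) x ^+ 2.
Definition Kcal (R : realType) (n : nat) (f : 'I_n.+1 -> R -> R) (x : R) : R :=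
  Num.sqrt (Kn11 f x * Kn f x - Kn01 f x ^+ 2) / Kn f x.

Definition k1 (R : realType) : R :=
  pi^-1 * (1 - ln 2 + (pi * Num.sqrt 3 + ln 8) / 9).
Definition k2 (R : realType) : R := (9 * pi)^-1 * (pi * Num.sqrt 3 + ln 8).
Definition k3 (R : realType) : R := (Num.sqrt 2)^-1 * (1 - ln 2).
Definition k4 (R : realType) : R := Num.sqrt 2 / 9 * (pi * Num.sqrt 3 + ln 8).

(* Main.v *)
(* After subtracting from Y = P_n'(x) its projection on X = P_n(x), write
   X = sum u_k eta_k and Y' = sum v'_k eta_k with v' orthogonal to u.  The
   intensity is the mass of |Y'| on {X = 0}, obtained by testing against the
   Fejer kernel
     F_L(x) = int_0^L (1 - s/L) cos(s x) ds = (1 - cos(L x)) / (L x^2) >= 0.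
   Split the indices as A + B.  By independence
     E[|Y'_A| F_L(X)] <= E|Y'_A| int_0^L |E exp(i s X_B)| ds,
   and the decay of phi with Bernoulli's inequality gives
     |E exp(i s X_B)| <= 1 / (1 + a q s^2 |u_B|^2),
   so this is at most |v'_A| pi / (2 sqrt(a q) |u_B|).  A balanced choice of A
   makes |v'_A| / |u_B| + |v'_B| / |u_A| <= (1 + sqrt 3) Kcal(x), uniformly in n.
   Since F_L(x) >= L/2 - L^3 x^2 / 24, which has mass 9/4 on |x| <= 3/L,
   Fatou's lemma as L -> oo yields
     rho_n(x) <= (2 pi / 9) (1 + sqrt 3) Kcal(x) / sqrt(a q).
   This is below the stated bound, through its k4 term alone, because
   E[eta^2] = 1 forces a q <= 1/2 and C2 >= 1. *)
Require Import Defs.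
From HB Require Import structures.
From mathcomp Require Import all_boot all_order all_algebra.
From mathcomp Require Import all_classical all_reals all_analysis.
From mathcomp Require Import measurable_realfun ring lra.
Import Order.TTheory GRing.Theory Num.Theory numFieldNormedType.Exports.
Local Open Scope classical_set_scope.
Local Open Scope ring_scope.
Set Implicit Arguments. Unset Strict Implicit. Unset Printing Implicit Defensive.

(** * The Fejer kernel *)

(** The obstacle is that [X] and [|Y'|] are built from the same variables, so the phase [exp(i s X)]
    does not separate from the weight. With the weight [|Y'_A|] only the phase of [X_A] is
    entangled: that of [X_B] factors out and carries all the decay in [s], while the weight costs
    its first moment, at most [|v'_A|] by Cauchy-Schwarz. The price is the ratio [|v'_A| / |u_B|],
    which is dangerous when [u] has almost no mass on [B]. If a single index carries much of [u], no
    cut balances [u]; orthogonality then helps, since Bessel's inequality forces [v'] to be small at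
    that index. The projection removed from [Y] is a multiple of [X], which vanishes only in the
    limit. Before the limit it contributes a factor [|X|], which the tail of the Fejer kernel does
    not control; hence the compactly supported [window] below the kernel, on which [|X|] is at most
    [4 / L]. The Fejer weight keeps the test function nonnegative and the range of [s] bounded, so
    that Fubini applies for each [L], and near [X = 0] only a lower bound on the density by
    continuity is called for. Retaining mass 9/4 out of the full [pi] is affordable for the stated
    constants. *)

Lemma le_of_derive_ge0 (R : realType) (F f : R -> R) :
  (forall x : R, is_derive x 1 F (f x)) -> (forall x, 0 <= x -> 0 <= f x) ->
  forall x, 0 <= x -> F 0 <= F x.
Proof.
move=> dF f0 x x0.
have cF : {within `[0, x], continuous F}.
  apply: continuous_subspaceT => z.
  by apply/differentiable_continuous/derivable1_diffP; case: (dF z).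
have [c /[!in_itv]/= /andP[c0 _] e] := MVT_segment x0 (fun z _ => dF z) cF.
by rewrite -subr_ge0 e mulr_ge0 ?f0// subr_ge0.
Qed.

Lemma integral_is_derive (R : realType) (F f : R -> R) (a b : R) :
  a < b -> (forall x : R, is_derive x 1 F (f x)) -> continuous f ->
  (\int[@lebesgue_measure R]_(x in `[a, b]) (f x)%:E = (F b - F a)%:E)%E.
Proof.
move=> ab dF cf; rewrite (@continuous_FTC2 _ f F)//.
- exact: continuous_subspaceT.
- have cF z : {for z, continuous F}.
    by apply/differentiable_continuous/derivable1_diffP; case: (dF z).
  split; first by move=> z _; case: (dF z).
  + by apply: cvg_at_right_filter; exact: cF.
  + by apply: cvg_at_left_filter; exact: cF.
- by move=> z _; rewrite derive1E; case: (dF z).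
Qed.

Lemma cos_ge1Bsqr (R : realType) (x : R) : 1 - x ^+ 2 / 2 <= cos x.
Proof.
have sinx (z : R) : 0 <= z -> sin z <= z.
  move=> z0; rewrite -subr_ge0.
  have := @le_of_derive_ge0 R (fun z => z - sin z) (fun z => 1 - cos z).
  rewrite sin0 subr0; apply => // y _; rewrite subr_ge0 cos_le1.
have pos (z : R) : 0 <= z -> 1 - z ^+ 2 / 2 <= cos z.
  move=> z0; rewrite -subr_ge0.
  have := @le_of_derive_ge0 R (fun z => cos z - (1 - z ^+ 2 / 2)) (fun z => z - sin z).
  rewrite /= cos0 expr0n/= mul0r subr0 subrr; apply => // y; last first.
    by move=> y0; rewrite subr_ge0 sinx.
  by apply: is_derive_eq; rewrite /GRing.scale/=; field.
by have [/pos//|x0] := leP 0 x; rewrite -cosN -sqrrN pos// oppr_ge0 ltW.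
Qed.

Lemma continuous_fejer (R : realType) (L x : R) :
  continuous (fun s : R => (1 - s / L) * cos (s * x)).
Proof.
move=> s; apply: cvgM.
  by apply: cvgB; [exact: cvg_cst|apply: cvgMl; exact: cvg_id].
apply: (@continuous_comp R R R (fun s => s * x) cos); last exact: continuous_cos.
by apply: cvgMl; exact: cvg_id.
Qed.

Lemma integral_fejer (R : realType) (L x : R) : 0 < L -> x != 0 ->
  (\int[@lebesgue_measure R]_(s in `[0%R, L]) ((1 - s / L) * cos (s * x))%:E
   = ((1 - cos (L * x)) / (L * x ^+ 2))%:E)%E.
Proof.
move=> L0 x0.
have dF (s : R) : is_derive s 1
    (fun s => (1 - s / L) * sin (s * x) / x - cos (s * x) / (L * x ^+ 2))
    ((1 - s / L) * cos (s * x)).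
  apply: is_derive_eq; rewrite /GRing.scale/=; field.
  by rewrite x0 gt_eqF.
rewrite (integral_is_derive L0 dF (@continuous_fejer R L x)).
congr EFin; rewrite !mul0r sin0 cos0; field.
by rewrite x0 gt_eqF.
Qed.

Lemma integrable_continuous_segment (R : realType) (f : R -> R) (a b : R) :
  continuous f -> (@lebesgue_measure R).-integrable `[a, b] (EFin \o f).
Proof.
move=> cf; apply: continuous_compact_integrable; first exact: segment_compact.
exact: continuous_subspaceT.
Qed.

(** Kept as the integral: the closed form divides by [x ^+ 2] and would give 0 at the origin, where
    the kernel equals [L / 2]. *)
Definition fejer (R : realType) (L x : R) : R :=
  fine (\int[@lebesgue_measure R]_(s in `[0%R, L]) ((1 - s / L) * cos (s * x))%:E)%E.

Lemma fejerE (R : realType) (L x : R) :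
  (\int[@lebesgue_measure R]_(s in `[0%R, L]) ((1 - s / L) * cos (s * x))%:E
   = (fejer L x)%:E)%E.
Proof.
rewrite fineK//; apply: integrable_fin_num => //.
have := @integrable_continuous_segment R _ 0 L (@continuous_fejer R L x). exact.
Qed.

(** The integral of [(1 - s / L) * (1 - (s * x) ^+ 2 / 2)] over [[0, L]]. For [L > 0] it is positive
    exactly when [|L * x| < sqrt 12]. *)
Definition fejer_minorant (R : realType) (L x : R) : R :=
  L / 2 - L ^+ 3 * x ^+ 2 / 24.

Lemma fejer_ge (R : realType) (L x : R) : 0 < L -> fejer_minorant L x <= fejer L x.
Proof.
move=> L0; rewrite -lee_fin -fejerE.
pose p (s : R) := (1 - s / L) * (1 - (s * x) ^+ 2 / 2).
have cp : continuous p.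
  move=> s; rewrite /p; apply: cvgM.
    by apply: cvgB; [exact: cvg_cst|apply: cvgMl; exact: cvg_id].
  apply: cvgB; first exact: cvg_cst.
  by apply: cvgMl; apply: (cvgM (f := fun s => s * x) (g := fun s => s * x)); apply: cvgMl; exact: cvg_id.
have <- : (\int[@lebesgue_measure R]_(s in `[0%R, L]) (p s)%:E = (fejer_minorant L x)%:E)%E.
  have dF (s : R) : is_derive s 1
      (fun s => s - s ^+ 2 / (2 * L) - s ^+ 3 * x ^+ 2 / 6 + s ^+ 4 * x ^+ 2 / (8 * L))
      (p s).
    by apply: is_derive_eq; rewrite /p /GRing.scale/=; field; rewrite gt_eqF.
  rewrite (integral_is_derive L0 dF cp) /fejer_minorant !expr0n/=; congr EFin; field.
  by rewrite gt_eqF.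
apply: le_integral => //.
- exact: (@integrable_continuous_segment R _ 0 L cp).
- exact: (@integrable_continuous_segment R _ 0 L (@continuous_fejer R L x)).
move=> s /[!inE]/=; rewrite in_itv/= => /andP[s0 sL]; rewrite lee_fin.
apply: ler_wpM2l; last exact: cos_ge1Bsqr.
by rewrite subr_ge0 ler_pdivrMr// mul1r.
Qed.

Lemma fejer_ge0 (R : realType) (L x : R) : 0 < L -> 0 <= fejer L x.
Proof.
(* The sign is visible in the closed form, which requires [x != 0]; the minorant settles the
   origin. *)
move=> L0; have [->|x0] := eqVneq x 0.
  apply: le_trans (fejer_ge 0 L0); rewrite /fejer_minorant expr0n/= mulr0 mul0r subr0.
  by rewrite divr_ge0// ltW.
rewrite /fejer integral_fejer//= divr_ge0 ?subr_ge0 ?cos_le1//.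
by rewrite mulr_ge0 ?sqr_ge0// ltW.
Qed.

Lemma integral_oneDsqr_le (R : realType) (c L : R) : 0 < c -> 0 < L ->
  (\int[@lebesgue_measure R]_(s in `[0%R, L]) (1 / (1 + c ^+ 2 * s ^+ 2))%:E
   <= (pi / (2 * c))%:E)%E.
Proof.
move=> c0 L0.
have den (s : R) : 0 < 1 + c ^+ 2 * s ^+ 2 by rewrite ltr_pwDl// mulr_ge0 ?sqr_ge0.
have dF (s : R) : is_derive s 1 (fun s => atan (c * s) / c) (1 / (1 + c ^+ 2 * s ^+ 2)).
  apply: is_derive_eq; rewrite /GRing.scale/=; field.
  by rewrite exprMn !gt_eqF.
rewrite (integral_is_derive L0 dF).
  rewrite lee_fin mulr0 atan0 mul0r subr0 invfM mulrA ler_pM2r ?invr_gt0//.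
  by rewrite ltW// atan_ltpi2.
move=> s; apply: cvgMr; apply: cvgV; first by rewrite gt_eqF.
apply: cvgD; first exact: cvg_cst.
by apply: cvgMr; apply: (cvgM (f := id) (g := id)); exact: cvg_id.
Qed.

(** Concavity of [ln]: [1 + x] is the convex combination of [1 + q * x] and [1] with weights [1/q]
    and [1 - 1/q], and [ln 1 = 0]. *)
Lemma powR_bernoulli (R : realType) (x q : R) : 0 <= x -> 1 <= q ->
  1 + q * x <= (1 + x) `^ q.
Proof.
move=> x0 q1; have q0 : 0 < q by exact: lt_le_trans q1.
have x1 : 0 < 1 + x by rewrite ltr_pwDl.
have qx1 : 0 < 1 + q * x by rewrite ltr_pwDl// mulr_ge0// ltW.
rewrite /powR gt_eqF// -[leLHS]lnK ?posrE// ler_expR.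
have qi : 0 <= q^-1 <= 1 by rewrite invr_ge0 (ltW q0)/= invf_le1.
have := @concave_ln R (Itv01 (proj1 (andP qi)) (proj2 (andP qi))) (1 + q * x) 1 qx1 ltr01.
rewrite !convRE ln1 mulr0 addr0 /=. rewrite /unstable.onem.
have -> : q^-1 * (1 + q * x) + (1 - q^-1) * 1 = 1 + x.
  by field; rewrite gt_eqF.
by rewrite ler_pdivrMl.
Qed.

(** * Finite-dimensional inequalities *)

Lemma prod_oneD_ge (R : realType) (I : finType) (B : pred I) (x : I -> R) :
  (forall i, 0 <= x i) -> 1 + \sum_(i | B i) x i <= \prod_(i | B i) (1 + x i).
Proof.
move=> x0.
(* Nonnegativity of the partial sum is carried through the induction because the cross term
   [x i * z] is dropped. *)
suff [] : 1 + \sum_(i | B i) x i <= \prod_(i | B i) (1 + x i) /\ 0 <= \sum_(i | B i) x i by [].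
elim/big_rec2 : _ => [|i z y _ [yz z0]]; first by rewrite addr0.
have xi := x0 i; split; last exact: addr_ge0.
have := mulr_ge0 xi z0; have : (1 + x i) * (1 + z) <= (1 + x i) * y.
  by rewrite ler_wpM2l//; lra.
lra.
Qed.

(** Bernoulli trades the exponent [q] for a factor [q], and the product is reduced to its linear
    terms. What remains is a Lorentzian in [s] that sees [u] only through its mass on [B], whatever
    the number of factors. *)
Lemma prod_charfun_bound (R : realType) (I : finType) (B : pred I) (u : I -> R) (a q s : R) :
  0 < a -> 1 <= q ->
  \prod_(j | B j) (1 / (1 + a * (s * u j) ^+ 2) `^ q) <=
  1 / (1 + a * q * s ^+ 2 * \sum_(j | B j) u j ^+ 2).
Proof.
move=> a0 q1.
have q0 : 0 < q by exact: lt_le_trans q1.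
have z0 j : 0 <= a * (s * u j) ^+ 2 by rewrite mulr_ge0 ?sqr_ge0// ltW.
have -> : a * q * s ^+ 2 * \sum_(j | B j) u j ^+ 2 =
    \sum_(j | B j) q * (a * (s * u j) ^+ 2).
  by rewrite big_distrr/=; apply: eq_bigr => j _; ring.
have qz0 j : 0 <= q * (a * (s * u j) ^+ 2) by rewrite mulr_ge0// ltW.
have S0 : 0 < 1 + \sum_(j | B j) q * (a * (s * u j) ^+ 2).
  by rewrite ltr_pwDl// sumr_ge0.
have -> : \prod_(j | B j) (1 / (1 + a * (s * u j) ^+ 2) `^ q) =
    1 / \prod_(j | B j) (1 + a * (s * u j) ^+ 2) `^ q.
  by rewrite prodf_div big1_eq.
rewrite !div1r lef_pV2 ?posrE//; last first.
  by apply: prodr_gt0 => j _; apply: powR_gt0; rewrite ltr_pwDl.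
apply: le_trans (prod_oneD_ge _ qz0) _.
apply: ler_prod => j _; rewrite powR_bernoulli// andbT.
by rewrite addr_ge0.
Qed.

(** Bessel's inequality for the basis vector [e_j] against the orthogonal pair [u], [v], cleared of
    denominators so that [v = 0] is allowed. The vector [V u_j u + K v_j v] has squared norm [K V t]
    and [j]-th coordinate [t], hence [t^2 <= K V t]. *)
Lemma bessel_two (R : realType) (I : finType) (u v : I -> R) (j : I) :
  \sum_k u k * v k = 0 -> 0 < \sum_k u k ^+ 2 ->
  (\sum_k v k ^+ 2) * u j ^+ 2 + (\sum_k u k ^+ 2) * v j ^+ 2 <=
  (\sum_k u k ^+ 2) * \sum_k v k ^+ 2.
Proof.
set K := \sum_k u k ^+ 2; set V := \sum_k v k ^+ 2 => uv K0.
set t := _ + _.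
have V0 : 0 <= V by apply: sumr_ge0 => k _; exact: sqr_ge0.
have t0 : 0 <= t by rewrite addr_ge0// mulr_ge0 ?sqr_ge0// ltW.
have h : \sum_k (V * u j * u k + K * v j * v k) ^+ 2 = K * V * t.
  rewrite (eq_bigr (fun k => (V * u j) ^+ 2 * u k ^+ 2 +
    2 * (V * u j) * (K * v j) * (u k * v k) + (K * v j) ^+ 2 * v k ^+ 2)); last first.
    by move=> k _; ring.
  rewrite !big_split/= -!big_distrr/= uv -/K -/V /t; ring.
have : t ^+ 2 <= K * V * t.
  rewrite -h (bigD1 j)//= -[leLHS]addr0 lerD//; last first.
    by apply: sumr_ge0 => k _; exact: sqr_ge0.
  by rewrite le_eqVlt; apply/orP; left; apply/eqP; rewrite /t; ring.
have [->|tn0] := eqVneq t 0; first by rewrite mulr_ge0// ltW.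
have tp : 0 < t by rewrite lt_neqAle eq_sym tn0.
by rewrite expr2 ler_pM2r.
Qed.

(* If one coordinate of [u] carries a third of its mass, split it off; otherwise
   cut the index set at the first prefix carrying a third of the mass. *)
Lemma balanced_split (R : realType) (m : nat) (u v : 'I_m -> R) (kappa : R) :
  \sum_k u k * v k = 0 -> 0 < \sum_k u k ^+ 2 -> 0 <= kappa ->
  \sum_k v k ^+ 2 = kappa ^+ 2 * \sum_k u k ^+ 2 ->
  exists (A : {set 'I_m}) (r1 r2 : R), [/\ 0 <= r1, 0 <= r2,
    \sum_(k in A) v k ^+ 2 <= r1 ^+ 2 * \sum_(k in ~: A) u k ^+ 2,
    \sum_(k in ~: A) v k ^+ 2 <= r2 ^+ 2 * \sum_(k in A) u k ^+ 2 &
    r1 + r2 <= (1 + Num.sqrt 3) * kappa].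
Proof.
move=> uv; set K := \sum_k u k ^+ 2 => K0 kappa0 Vk.
have split_sum (w : 'I_m -> R) (A : {set 'I_m}) :
    \sum_k w k = \sum_(k in A) w k + \sum_(k in ~: A) w k.
  rewrite (bigID (mem A))/=; congr (_ + _).
  by apply: eq_bigl => k; rewrite inE.
have sum0 (w : 'I_m -> R) (A : {set 'I_m}) : 0 <= \sum_(k in A) w k ^+ 2.
  by apply: sumr_ge0 => k _; exact: sqr_ge0.
have s3 : Num.sqrt 3 ^+ 2 = 3 :> R by rewrite sqr_sqrtr.
have s30 : 0 <= Num.sqrt 3 :> R by exact: sqrtr_ge0.
have [[j uj]|small] := pselect (exists j, K / 3 <= u j ^+ 2).
  (* [bessel_two] reads [v_j^2 <= kappa^2 (K - u_j^2)], which gives the ratio [kappa]. For the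
     complement, all of [v] has mass [kappa^2 K <= 3 kappa^2 u_j^2]. *)
  exists [set j]%SET; exists kappa; exists (Num.sqrt 3 * kappa); split => //.
  - by rewrite mulr_ge0.
  - have := bessel_two j uv K0; rewrite -/K Vk.
    have := split_sum (fun k => u k ^+ 2) [set j]%SET; rewrite -/K !big_set1 => KE.
    have -> : \sum_(k in ~: [set j]%SET) u k ^+ 2 = K - u j ^+ 2 by rewrite KE; ring.
    move=> h; rewrite -(ler_pM2l K0); clear KE; clearbody K; clear - h; lra.
  - rewrite big_set1 exprMn s3.
    have := split_sum (fun k => v k ^+ 2) [set j]%SET; rewrite Vk big_set1.
    have := sqr_ge0 (v j); have := sqr_ge0 kappa.
    move: (\sum_(k in ~: _) _) => VB k20 vj0 e; clearbody K; clear - k20 vj0 e uj; nra.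
  - by rewrite mulrDl mul1r.
pose S (i : nat) := \sum_(k < m | (k < i)%N) u k ^+ 2.
have exP : exists i, K / 3 <= S i.
  exists m; rewrite /S (eq_bigl xpredT); last by move=> k; rewrite /= ltn_ord.
  by rewrite -/K; lra.
case: (ex_minnP exP) => i Si imin.
(* The previous prefix stays below [K / 3] and one more coordinate adds less than [K / 3], so the
   cut cannot overshoot. *)
have Si2 : S i <= 2 * K / 3.
  case: i Si imin => [|i] Si imin; first by move: Si; rewrite /S big_pred0//; lra.
  have Sle : S i < K / 3.
    by rewrite ltNge; apply/negP => /imin; rewrite ltnn.
  suff : S i.+1 <= S i + K / 3 by lra.
  rewrite /S (bigID (fun k : 'I_m => (k < i)%N))/=.
  rewrite (eq_bigl (fun k : 'I_m => (k < i)%N)); last first.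
    move=> k; rewrite ltnS; case: ltnP => ki; first by rewrite andbT ltnW.
    by rewrite andbF.
  rewrite lerD2l.
  have [im|im] := ltnP i m; last first.
    rewrite big_pred0; first by lra.
    by move=> k; rewrite (leq_trans (ltn_ord k) im) andbF.
  rewrite (eq_bigl (pred1 (Ordinal im))); last first.
    by move=> k; rewrite ltnS -leqNgt -eqn_leq.
  rewrite big_pred1_eq leNgt; apply/negP => h; apply: small.
  by exists (Ordinal im); exact: ltW.
pose A := [set k : 'I_m | (k < i)%N]%SET.
have SA : \sum_(k in A) u k ^+ 2 = S i by apply: eq_bigl => k; rewrite inE.
have KA := split_sum (fun k => u k ^+ 2) A; rewrite -/K SA in KA.
have VA := split_sum (fun k => v k ^+ 2) A; rewrite Vk in VA.
have VA0 := sum0 v A; have VB0 := sum0 v (~: A).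
move: VA VA0 VB0; set a := \sum_(k in A) v k ^+ 2; set b := \sum_(k in ~: A) v k ^+ 2.
move=> VA VA0 VB0.
(* Both sides now carry at least [K / 3] of [u]. The squares of the two ratios add up to
   [3 kappa^2], so their sum is at most [sqrt 6 * kappa], and
   [6 <= 4 + 2 sqrt 3 = (1 + sqrt 3)^2]. *)
exists A; exists (Num.sqrt (3 * a / K)); exists (Num.sqrt (3 * b / K)).
rewrite SA -/a -/b.
have a30 : 0 <= 3 * a / K by rewrite divr_ge0 ?mulr_ge0// ltW.
have b30 : 0 <= 3 * b / K by rewrite divr_ge0 ?mulr_ge0// ltW.
clearbody K a b; split; rewrite ?sqrtr_ge0//.
- rewrite sqr_sqrtr// mulrAC ler_pdivlMr//; move: KA VA0 VB0 Si Si2 K0; move: (S i) (\sum_(k in ~: _) _) => Si' Su; clear; nra.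
- rewrite sqr_sqrtr// mulrAC ler_pdivlMr//; move: KA VA0 VB0 Si Si2 K0; move: (S i) (\sum_(k in ~: _) _) => Si' Su; clear; nra.
- have := sqr_sqrtr a30; have := sqr_sqrtr b30.
  have := sqrtr_ge0 (3 * a / K); have := sqrtr_ge0 (3 * b / K).
  set r := Num.sqrt (3 * a / K); set t := Num.sqrt (3 * b / K) => t0 r0 tE rE.
  have rt : r ^+ 2 + t ^+ 2 = 3 * kappa ^+ 2.
    by rewrite rE tE -mulrDl -mulrDr -VA; field; rewrite gt_eqF.
  rewrite -(@ler_pXn2r _ 2)// ?nnegrE ?addr_ge0 ?mulr_ge0 ?addr_ge0//.
  have := sqr_ge0 (r - t); have := sqr_ge0 kappa.
  have : 1 <= Num.sqrt 3 :> R by rewrite -[leLHS]sqrtr1 ler_wsqrtr// ler1n.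
  move=> s31 k20 rt2.
  rewrite exprMn (sqrrD 1) s3 expr1n mul1r.
  have : 6 * kappa ^+ 2 <= (1 + Num.sqrt 3 *+ 2 + 3) * kappa ^+ 2.
    by rewrite ler_wpM2r// -mulr_natr; lra.
  move: rt rt2 => {}rt rt2 h6; rewrite sqrrB in rt2; rewrite sqrrD; clear - rt rt2 h6; lra.
Qed.

(** * Numerical comparison of the constants *)

Lemma ln2_ge_half (R : realType) : 1 / 2 <= ln 2 :> R.
Proof.
rewrite -ler_expR lnK ?posrE// -lef_pV2 ?posrE ?expR_gt0// -expRN.
by apply: le_trans (expR_ge1Dx _); lra.
Qed.

Lemma ln2_le1 (R : realType) : ln 2 <= 1 :> R.
Proof.
rewrite -ler_expR lnK ?posrE//; apply: le_trans (expR_ge1Dx _); lra.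
Qed.

Lemma ln8E (R : realType) : ln 8 = 3 * ln 2 :> R.
Proof.
have -> : 8 = 2 ^+ 3 :> R by rewrite -natrX.
by rewrite lnXn// mulr_natl.
Qed.

(** Here [b] stands for [1 / sqrt (a q)]. Since [b^2 C2^2 >= 2], the [k4] term is at least [2 b k4],
    and it remains to see that [pi (1 + sqrt 3 - sqrt 6) <= 3 sqrt 2 ln 2]. *)
Lemma constant_bound (R : realType) (b C2 C3 : R) : 0 < b -> 2 <= b ^+ 2 ->
  1 <= C2 -> 0 < C3 ->
  (2 * pi / 9) * (1 + Num.sqrt 3) * b <=
  b ^+ 2 * (k1 R + C3 * k2 R + b * C2 * (k3 R + C2 * k4 R)).
Proof.
move=> b0 b2 C21 C30.
have p0 : 0 < pi :> R := pi_gt0 R.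
have p4 : pi <= 4 :> R by have := pihalf_lt2 R; lra.
have s3 : Num.sqrt 3 ^+ 2 = 3 :> R by rewrite sqr_sqrtr.
have s30 : 0 < Num.sqrt 3 :> R by rewrite sqrtr_gt0.
have s2 : Num.sqrt 2 ^+ 2 = 2 :> R by rewrite sqr_sqrtr.
have s20 : 0 < Num.sqrt 2 :> R by rewrite sqrtr_gt0.
have l2 := ln2_ge_half R; have l21 := ln2_le1 R.
have k10 : 0 <= k1 R.
  rewrite /k1 mulr_ge0 ?invr_ge0 ?ltW// ln8E; nra.
have k20 : 0 <= k2 R.
  rewrite /k2 mulr_ge0 ?invr_ge0 ?mulr_ge0 ?ltW// ln8E; nra.
have k30 : 0 <= k3 R.
  by rewrite /k3 mulr_ge0 ?subr_ge0// invr_ge0 ltW.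
have s6 : (61 / 25) <= Num.sqrt 2 * Num.sqrt 3 :> R.
  rewrite leNgt; apply/negP => h.
  have : (Num.sqrt 2 * Num.sqrt 3) ^+ 2 < (61 / 25) ^+ 2 :> R.
    by rewrite ltrXn2r// mulr_ge0// ltW.
  by rewrite exprMn s2 s3; lra.
have s31 : Num.sqrt 3 <= (87 / 50) :> R.
  rewrite leNgt; apply/negP => h.
  have : (87 / 50) ^+ 2 < Num.sqrt 3 ^+ 2 :> R by rewrite ltrXn2r//; lra.
  by rewrite s3; lra.
have s21 : (7 / 5) <= Num.sqrt 2 :> R.
  rewrite leNgt; apply/negP => h.
  have : Num.sqrt 2 ^+ 2 < (7 / 5) ^+ 2 :> R by rewrite ltrXn2r// ltW.
  by rewrite s2; lra.
have k40 : (2 * pi / 9) * (1 + Num.sqrt 3) <= 2 * k4 R.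
  rewrite /k4 ln8E.
  (* Crude decimals suffice: [pi <= 4] bounds the left side by 1.2, and [ln 2 >= 1/2] makes the
     right side at least 2.1. *)
  have h1 : pi * (1 + Num.sqrt 3 - Num.sqrt 2 * Num.sqrt 3) <= 4 * (3 / 10) :> R by nra.
  have h2 : (7 / 5) * (3 / 2) <= Num.sqrt 2 * (3 * ln 2) :> R by nra.
  by lra.
have bb : b * k4 R * 2 <= b ^+ 2 * (b * C2 * (C2 * k4 R)).
  have k4p : 0 <= k4 R by apply: le_trans (_ : (2 * pi / 9) * (1 + Num.sqrt 3) / 2 <= _); [nra|lra].
  have -> : b ^+ 2 * (b * C2 * (C2 * k4 R)) = (b * k4 R) * (b ^+ 2 * C2 ^+ 2) by ring.
  have bk : 0 <= b * k4 R by apply: mulr_ge0 => //; exact: ltW.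
  apply: ler_wpM2l => //.
  have C2s : 1 <= C2 ^+ 2 by exact: exprn_ege1.
  by have := ler_wpM2l (sqr_ge0 b) C2s; lra.
move: (k1 R) k10 (k2 R) k20 (k3 R) k30 (k4 R) k40 bb => x1 x10 x2 x20 x3 x30 x4 x40 bb.
have h0 : 0 <= b ^+ 2 * (x1 + C3 * x2 + b * C2 * x3).
  have C20 : 0 <= C2 by lra.
  have C3p := ltW C30; have bp := ltW b0.
  by rewrite !(mulr_ge0, addr_ge0, sqr_ge0).
have : (2 * pi / 9) * (1 + Num.sqrt 3) * b <= 2 * x4 * b by rewrite ler_wpM2r// ltW.
lra.
Qed.

(** * Independence *)

Section independence.
Context d (T : measurableType d) (R : realType) (P : probability T R) (m : nat).
Variable X : 'I_m -> {RV P >-> R}.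
Hypothesis indepX : mutually_independent P (fun k => (X k : T -> R)).

(* A generating pi-system of the sigma-algebra of the [X i], [i] in [A]. *)
Definition cylinder (A : {set 'I_m}) : set (set T) :=
  [set E | exists B : 'I_m -> set R, [/\ forall i, measurable (B i),
    forall i, i \notin A -> B i = setT &
    E = \bigcap_(i in [set: 'I_m]) (X i @^-1` B i)]].

Lemma measurable_cylinder A : cylinder A `<=` measurable.
Proof.
move=> E [B [mB _ ->]]; apply: fin_bigcap_measurable => // i _.
by rewrite -[_ @^-1` _]setTI; exact: measurable_funP.
Qed.

Lemma sigma_cylinder_measurable A : <<s cylinder A >> `<=` measurable.
Proof.
by apply: smallest_sub; [exact: sigma_algebra_measurable|exact: measurable_cylinder].
Qed.

Lemma cylinderT A : cylinder A setT.
Proof.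
by exists (fun=> setT); split => //; apply/seteqP; split.
Qed.

Lemma cylinder_setI_closed A : setI_closed (cylinder A).
Proof.
move=> _ _ [B [mB BA ->]] [C [mC CA ->]].
exists (fun i => B i `&` C i); split; first by move=> i; exact: measurableI.
  by move=> i iA; rewrite BA// CA// setTI.
by rewrite -bigcapI.
Qed.

(** The two families are merged coordinate by coordinate; by disjointness one of them is [setT] at
    every index, so each factor of the product splits. *)
Lemma cylinder_indep (A B : {set 'I_m}) E F : (forall i, i \in A -> i \notin B) ->
  cylinder A E -> cylinder B F -> (P (E `&` F) = P E * P F)%E.
Proof.
move=> AB [C [mC CA ->]] [D [mD DB ->]].
rewrite -bigcapI (indepX (B := fun i => C i `&` D i)); last first.
  by move=> i; exact: measurableI.
rewrite (indepX mC) (indepX mD) -big_split/=; apply: eq_bigr => i _.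
have [iA|iA] := boolP (i \in A).
  by rewrite (DB i (AB i iA)) setIT preimage_setT probability_setT mule1.
by rewrite (CA i)// setTI preimage_setT probability_setT mul1e.
Qed.

(** Two uses of uniqueness of finite measures on a pi-system: [H |-> P (H & C)] and
    [H |-> P C * P H] agree on cylinders, hence on what they generate. The first use extends in [E]
    with [F] fixed, the second in [F] with a cylinder in place of [E]. *)
Lemma sigma_indep (A B : {set 'I_m}) E F : (forall i, i \in A -> i \notin B) ->
  <<s cylinder A >> E -> <<s cylinder B >> F -> (P (E `&` F) = P E * P F)%E.
Proof.
move=> AB.
have step G C H : setI_closed G -> G `<=` measurable -> G setT ->
    measurable C -> (forall A, G A -> P (A `&` C) = (P A * P C)%E) ->
    <<s G >> H -> P (H `&` C) = (P H * P C)%E.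
  move=> GI Gm GT mC GC sH.
  have PC : (fine (P C))%:E = P C by rewrite fineK// fin_num_measure.
  have r0 : 0 <= fine (P C) by exact: fine_ge0.
  have PCoo : (P C < +oo)%E by rewrite (le_lt_trans (probability_le1 P mC))// ltry.
  suff : mrestr P mC H = mscale (NngNum r0) P H.
    by rewrite /mrestr /mscale [X in _ = (X%:E * _)%E]/= PC => ->; rewrite muleC.
  apply: (g_sigma_algebra_measure_unique G Gm (fun=> setT)) sH => //.
  - by rewrite bigcup_const.
  - move=> A0 /GC PA; rewrite /mrestr /mscale [X in _ = (X%:E * _)%E]/= PC muleC.
    exact: PA.
  - by move=> _; rewrite [X in (X < _)%E](_ : _ = P C)//; congr (P _); rewrite setTI.
move=> sE sF.
apply: (step (cylinder A)) sE => //.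
- exact: cylinder_setI_closed.
- exact: measurable_cylinder.
- exact: cylinderT.
- exact: sigma_cylinder_measurable sF.
move=> E' cE'; rewrite setIC muleC.
apply: (step (cylinder B)) sF => //.
- exact: cylinder_setI_closed.
- exact: measurable_cylinder.
- exact: cylinderT.
- exact: measurable_cylinder cE'.
by move=> F' cF'; rewrite setIC muleC; exact: cylinder_indep AB _ _.
Qed.

(** This is how [U] is said to depend only on the [X i] with [i] in [A]. Changing the sigma-algebra
    of the source type lets the usual closure lemmas for measurable functions apply unchanged. *)
Definition measurable_wrt (A : {set 'I_m}) (U : T -> R) :=
  @measurable_fun _ _ (g_sigma_algebraType (cylinder A)) R setT U.

Lemma measurable_wrtX (A : {set 'I_m}) i : i \in A -> measurable_wrt A (X i).
Proof.
move=> iA _ B mB; rewrite setTI; apply: sub_sigma_algebra.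
exists (fun j => if j == i then B else setT); split.
- by move=> j; case: ifP.
- by move=> j; case: eqP => // ->; rewrite iA.
- apply/seteqP; split => [w Bw j _ /=|w]; first by case: eqP => [->|].
  by move=> /(_ i I)/=; rewrite eqxx.
Qed.

Lemma measurable_wrt_measurable A U : measurable_wrt A U -> measurable_fun [set: T] U.
Proof. by move=> mU _ B mB; exact: sigma_cylinder_measurable (mU measurableT B mB). Qed.

Lemma measurable_wrt_sum A (c : 'I_m -> R) :
  measurable_wrt A (fun w => \sum_(i in A) X i w * c i).
Proof.
rewrite /measurable_wrt; under eq_fun do rewrite big_mkcond/=.
apply: measurable_sum => i; have [iA|iA] := boolP (i \in A); last exact: measurable_cst.
apply: measurable_funM; last exact: measurable_cst.
exact: measurable_wrtX.
Qed.

(** By [sigma_indep] the law of [(U, W)] agrees on rectangles with the product of the two laws,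
    hence equals it; Fubini then factors the integral of [x * y]. *)
Lemma expectationM (A B : {set 'I_m}) (U W : T -> R) : (forall i, i \in A -> i \notin B) ->
  measurable_wrt A U -> measurable_wrt B W ->
  P.-integrable setT (EFin \o U) -> P.-integrable setT (EFin \o W) ->
  P.-integrable setT (fun w => (U w * W w)%:E) ->
  (\int[P]_w (U w * W w)%:E = \int[P]_w (U w)%:E * \int[P]_w (W w)%:E)%E.
Proof.
move=> AB mU mW iU iW iUW.
have mU' := measurable_wrt_measurable mU; have mW' := measurable_wrt_measurable mW.
pose UR : {mfun T >-> R} := HB.pack U (isMeasurableFun.Build _ _ _ _ _ mU').
pose WR : {mfun T >-> R} := HB.pack W (isMeasurableFun.Build _ _ _ _ _ mW').
have mp : measurable_fun [set: T] (fun w => (U w, W w)) by exact: measurable_fun_pair.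
pose pR : {mfun T >-> (R * R)%type} := HB.pack (fun w => (U w, W w)) (isMeasurableFun.Build _ _ _ _ _ mp).
pose f (p : R * R) := (p.1 * p.2)%:E.
have mf : measurable_fun [set: R * R] f.
  by apply/measurable_EFinP; exact: measurable_funM.
have joint C : measurable C -> distribution P pR C = (distribution P UR \x distribution P WR)%E C.
  move=> mC; apply/esym; apply: product_measure_unique => //= B1 B2 mB1 mB2.
  rewrite /distribution/= /pushforward.
  transitivity (P ((U @^-1` B1) `&` (W @^-1` B2))); first by congr (P _).
  apply: (sigma_indep AB).
    by rewrite -[_ @^-1` _]setTI; exact: mU.
  by rewrite -[_ @^-1` _]setTI; exact: mW.
have intf : (distribution P UR \x distribution P WR)%E.-integrable setT f.
  apply/integrableP; split => //.
  rewrite (eq_measure_integral (distribution P pR)); last by move=> C mC _; apply/esym; exact: joint.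
  rewrite ge0_integral_distribution//; last exact: measurableT_comp.
  by move/integrableP : iUW => [].
transitivity (\int[distribution P pR]_p f p)%E.
  by rewrite integral_distribution.
rewrite (eq_measure_integral (distribution P UR \x distribution P WR)%E); last first.
  by move=> C mC _; exact: joint.
rewrite -integral12_prod_meas1// /f/=.
have iW2 : (distribution P WR).-integrable setT EFin.
  by apply: integrable_pushforward.
have iU2 : (distribution P UR).-integrable setT EFin.
  by apply: integrable_pushforward.
have EW : (\int[distribution P WR]_x x%:E = \int[P]_w (W w)%:E)%E.
  by rewrite integral_distribution.
have Wfin : (\int[P]_w (W w)%:E)%E \is a fin_num by exact: integrable_fin_num.
transitivity (\int[distribution P UR]_x (x%:E * \int[P]_w (W w)%:E))%E.
  apply: eq_integral => x _; rewrite -EW -integralZl//.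
rewrite -(fineK Wfin) integralZr//; congr (_ * _)%E.
by rewrite integral_distribution.
Qed.

End independence.

(** * Characteristic functions of partial sums *)

Lemma integrableM_le1 d (T : measurableType d) (R : realType)
    (mu : {measure set T -> \bar R}) (U h : T -> R) :
  mu.-integrable setT (EFin \o U) -> measurable_fun [set: T] h ->
  (forall w, `|h w| <= 1) -> mu.-integrable setT (fun w => (U w * h w)%:E).
Proof.
move=> iU mh h1; apply: (le_integrable measurableT _ _ iU) => //.
  apply/measurable_EFinP; apply: measurable_funM => //.
  by case/integrableP : iU => /measurable_EFinP.
by move=> w _; rewrite lee_fin /= normrM ler_piMr.
Qed.

Lemma integrable_le1 d (T : measurableType d) (R : realType)
    (P : probability T R) (h : T -> R) :
  measurable_fun [set: T] h -> (forall w, `|h w| <= 1) ->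
  P.-integrable setT (EFin \o h).
Proof.
move=> mh h1; apply: (le_integrable measurableT _ _ (finite_measure_integrable_cst P 1 measurableT)) => //.
  exact/measurable_EFinP.
by move=> w _; rewrite /= lee_fin normr1.
Qed.

Lemma normr_cos_le1 (R : realType) (x : R) : `|cos x| <= 1.
Proof. by rewrite ler_norml cos_geN1 cos_le1. Qed.

Lemma normr_sin_le1 (R : realType) (x : R) : `|sin x| <= 1.
Proof. by rewrite ler_norml sin_geN1 sin_le1. Qed.

Lemma measurable_cos (R : realType) : measurable_fun [set: R] (@cos R).
Proof. by apply: continuous_measurable_fun; exact: continuous_cos. Qed.

Lemma measurable_sin (R : realType) : measurable_fun [set: R] (@sin R).
Proof. by apply: continuous_measurable_fun; exact: continuous_sin. Qed.

Section charfun.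
Context d (T : measurableType d) (R : realType) (P : probability T R) (m : nat).
Variable X : 'I_m -> {RV P >-> R}.
Hypothesis indepX : mutually_independent P (fun k => (X k : T -> R)).

Definition partial_sum (u : 'I_m -> R) (A : {set 'I_m}) (w : T) : R :=
  \sum_(i in A) X i w * u i.

Lemma measurable_wrt_cos A (S : T -> R) (s : R) : measurable_wrt X A S ->
  measurable_wrt X A (fun w => cos (s * S w)).
Proof.
move=> mS; apply: (@measurableT_comp _ _ _ _ _ _ cos); first exact: measurable_cos.
by apply: measurable_funM => //; exact: measurable_cst.
Qed.

Lemma measurable_wrt_sin A (S : T -> R) (s : R) : measurable_wrt X A S ->
  measurable_wrt X A (fun w => sin (s * S w)).
Proof.
move=> mS; apply: (@measurableT_comp _ _ _ _ _ _ sin); first exact: measurable_sin.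
by apply: measurable_funM => //; exact: measurable_cst.
Qed.

Lemma charReE (S : T -> R) (s : R) : charRe P S s = \int[P]_w cos (s * S w).
Proof. by rewrite /charRe unlock. Qed.

Lemma charImE (S : T -> R) (s : R) : charIm P S s = \int[P]_w sin (s * S w).
Proof. by rewrite /charIm unlock. Qed.

Lemma RintegralM_indep (A B : {set 'I_m}) (U W : T -> R) :
  (forall i, i \in A -> i \notin B) ->
  measurable_wrt X A U -> measurable_wrt X B W ->
  P.-integrable setT (EFin \o U) -> (forall w, `|W w| <= 1) ->
  \int[P]_w (U w * W w) = (\int[P]_w U w) * \int[P]_w W w.
Proof.
move=> AB mU mW iU W1.
have mW' := measurable_wrt_measurable mW.
have iW := integrable_le1 P mW' W1.
rewrite /Rintegral (expectationM indepX AB mU mW)//; last exact: integrableM_le1.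
by rewrite fineM//; exact: integrable_fin_num.
Qed.

(** Real and imaginary parts of [E[U exp(is(S + S'))] = E[U exp(isS)] E[exp(isS')]]. The weight 1
    yields the product formula for characteristic functions, a general weight the Fejer estimate. *)
Lemma charfunD (A B : {set 'I_m}) (U S S' : T -> R) (s : R) :
  (forall i, i \in A -> i \notin B) ->
  measurable_wrt X A U -> measurable_wrt X A S -> measurable_wrt X B S' ->
  P.-integrable setT (EFin \o U) ->
  \int[P]_w (U w * cos (s * (S w + S' w))) =
    (\int[P]_w (U w * cos (s * S w))) * charRe P S' s -
    (\int[P]_w (U w * sin (s * S w))) * charIm P S' s /\
  \int[P]_w (U w * sin (s * (S w + S' w))) =
    (\int[P]_w (U w * sin (s * S w))) * charRe P S' s +
    (\int[P]_w (U w * cos (s * S w))) * charIm P S' s.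
Proof.
move=> AB mU mS mS' iU.
have mc := measurable_wrt_cos s mS; have ms := measurable_wrt_sin s mS.
have mc' := measurable_wrt_cos s mS'; have ms' := measurable_wrt_sin s mS'.
have c1 w : `|cos (s * S w)| <= 1 := normr_cos_le1 _.
have s1 w : `|sin (s * S w)| <= 1 := normr_sin_le1 _.
have c1' w : `|cos (s * S' w)| <= 1 := normr_cos_le1 _.
have s1' w : `|sin (s * S' w)| <= 1 := normr_sin_le1 _.
have iUc := integrableM_le1 iU (measurable_wrt_measurable mc) c1.
have iUs := integrableM_le1 iU (measurable_wrt_measurable ms) s1.
have mUc : measurable_wrt X A (fun w => U w * cos (s * S w)) by exact: measurable_funM.
have mUs : measurable_wrt X A (fun w => U w * sin (s * S w)) by exact: measurable_funM.
have iUcc := integrableM_le1 iUc (measurable_wrt_measurable mc') c1'.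
have iUcs := integrableM_le1 iUc (measurable_wrt_measurable ms') s1'.
have iUsc := integrableM_le1 iUs (measurable_wrt_measurable mc') c1'.
have iUss := integrableM_le1 iUs (measurable_wrt_measurable ms') s1'.
rewrite charReE charImE.
rewrite -!(RintegralM_indep AB)//.
rewrite -RintegralB// -RintegralD//; split; apply: eq_Rintegral => w _.
  by rewrite mulrDr cosD; ring.
by rewrite mulrDr sinD; ring.
Qed.

(** Squared moduli avoid complex numbers and square roots. Indices are removed one at a time, each
    by the identity [(ac - bd)^2 + (bc + ad)^2 = (a^2 + b^2)(c^2 + d^2)]. *)
Lemma charfun_partial_sum (u : 'I_m -> R) (B : {set 'I_m}) (s : R) :
  charRe P (partial_sum u B) s ^+ 2 + charIm P (partial_sum u B) s ^+ 2 =
  \prod_(i in B) (charRe P (X i) (s * u i) ^+ 2 + charIm P (X i) (s * u i) ^+ 2).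
Proof.
have [k] := ubnP #|B|; elim: k B => // k IH B Bk.
have [->|[i iB]] := set_0Vmem B.
  rewrite big_set0 charReE charImE.
  under eq_Rintegral do rewrite /partial_sum big_set0 mulr0 cos0.
  under [X in _ + X ^+ 2]eq_Rintegral do rewrite /partial_sum big_set0 mulr0 sin0.
  rewrite !Rintegral_cst//= probability_setT/= mul0r mulr1 expr1n expr0n/=.
  by rewrite addr0.
rewrite (big_setD1 i)//= -IH; last by rewrite (cardsD1 i B) iB in Bk.
have disj j : j \in [set i]%SET -> j \notin (B :\ i)%SET.
  by rewrite inE => /eqP ->; rewrite !inE eqxx.
have mS A : measurable_wrt X A (partial_sum u A) by exact: measurable_wrt_sum.
have m1 : measurable_wrt X [set i]%SET (cst 1) by exact: measurable_cst.
have [h1 h2] := @charfunD [set i]%SET (B :\ i)%SET (cst 1) (partial_sum u [set i]%SET)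
  (partial_sum u (B :\ i)%SET) s disj m1
  (mS [set i]%SET) (mS (B :\ i)%SET)
  (finite_measure_integrable_cst P 1 measurableT).
have SE w : partial_sum u [set i]%SET w + partial_sum u (B :\ i)%SET w = partial_sum u B w.
  by rewrite /partial_sum big_set1 [RHS](big_setD1 i).
have SiE w : s * u i * X i w = s * partial_sum u [set i]%SET w.
  by rewrite /partial_sum big_set1; ring.
have hc : charRe P (X i) (s * u i) = \int[P]_w (1 * cos (s * partial_sum u [set i]%SET w)).
  by rewrite charReE; apply: eq_Rintegral => w _; rewrite mul1r SiE.
have hs : charIm P (X i) (s * u i) = \int[P]_w (1 * sin (s * partial_sum u [set i]%SET w)).
  by rewrite charImE; apply: eq_Rintegral => w _; rewrite mul1r SiE.
have kc : charRe P (partial_sum u B) s =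
    \int[P]_w (1 * cos (s * (partial_sum u [set i]%SET w + partial_sum u (B :\ i)%SET w))).
  by rewrite charReE; apply: eq_Rintegral => w _; rewrite mul1r SE.
have ks : charIm P (partial_sum u B) s =
    \int[P]_w (1 * sin (s * (partial_sum u [set i]%SET w + partial_sum u (B :\ i)%SET w))).
  by rewrite charImE; apply: eq_Rintegral => w _; rewrite mul1r SE.
rewrite hc hs kc ks [X in X ^+ 2 + _ = _]h1 [X in _ + X ^+ 2 = _]h2; ring.
Qed.

End charfun.

Section charfun_iid.
Context d (T : measurableType d) (R : realType) (P : probability T R) (n : nat).
Variable X : 'I_n.+1 -> {RV P >-> R}.
Hypothesis indepX : mutually_independent P (fun k => (X k : T -> R)).
Hypothesis iidX : identically_distributed P (fun k => (X k : T -> R)).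

Lemma charfun_ident i s : charRe P (X i) s = charRe P (X ord0) s /\
  charIm P (X i) s = charIm P (X ord0) s.
Proof.
have key (h : R -> R) : measurable_fun [set: R] h -> (forall x, `|h x| <= 1) ->
    \int[P]_w h (X i w) = \int[P]_w h (X ord0 w).
  move=> mh h1; rewrite /Rintegral; congr fine.
  have ih j : P.-integrable setT ((EFin \o h) \o X j).
    apply: (integrable_le1 P (h := h \o X j)) => [|w]; last exact: h1.
    exact: measurableT_comp.
  have mh' : measurable_fun [set: R] (EFin \o h) by exact/measurable_EFinP.
  rewrite -(integral_distribution mh' (ih i)) -(integral_distribution mh' (ih ord0)).
  by apply: eq_measure_integral => B mB _; exact: iidX.
rewrite !charReE !charImE; split.
  apply: (key (fun x => cos (s * x))) => [|x]; last exact: normr_cos_le1.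
  apply: (@measurableT_comp _ _ _ _ _ _ cos); first exact: measurable_cos.
  by apply: measurable_funM => //; exact: measurable_cst.
apply: (key (fun x => sin (s * x))) => [|x]; last exact: normr_sin_le1.
apply: (@measurableT_comp _ _ _ _ _ _ sin); first exact: measurable_sin.
by apply: measurable_funM => //; exact: measurable_cst.
Qed.

Variables (a q : R).
Hypotheses (a0 : 0 < a) (q1 : 1 <= q).
Hypothesis char_le : forall s : R,
  cmod (charRe P (X ord0) s) (charIm P (X ord0) s) <= 1 / (1 + a * s ^+ 2) `^ q.

Lemma charfun_partial_sum_le (u : 'I_n.+1 -> R) (B : {set 'I_n.+1}) (s : R) :
  charRe P (partial_sum X u B) s ^+ 2 + charIm P (partial_sum X u B) s ^+ 2 <=
  (1 / (1 + a * q * s ^+ 2 * \sum_(i in B) u i ^+ 2)) ^+ 2.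
Proof.
rewrite (charfun_partial_sum indepX).
have p0 j : 0 <= 1 / (1 + a * (s * u j) ^+ 2) `^ q by rewrite divr_ge0// powR_ge0.
apply: (@le_trans _ _ ((\prod_(j in B) (1 / (1 + a * (s * u j) ^+ 2) `^ q)) ^+ 2)).
  rewrite -prodrXl; apply: ler_prod => j _.
  have [-> ->] := charfun_ident j (s * u j).
  rewrite addr_ge0 ?sqr_ge0//=.
  have := char_le (s * u j); rewrite /cmod => h.
  rewrite -[leLHS]sqr_sqrtr ?addr_ge0 ?sqr_ge0//.
  by rewrite ler_pXn2r// nnegrE ?sqrtr_ge0.
rewrite ler_pXn2r ?nnegrE//; last 2 first.
- exact: prodr_ge0.
- rewrite divr_ge0// addr_ge0// mulr_ge0//; last by apply: sumr_ge0 => i _; exact: sqr_ge0.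
  by rewrite mulr_ge0 ?sqr_ge0// mulr_ge0// ltW// (lt_le_trans _ q1).
exact: prod_charfun_bound.
Qed.

End charfun_iid.

Lemma integrableZr_EFin d (T : measurableType d) (R : realType)
    (mu : {measure set T -> \bar R}) (D : set T) (g : T -> R) (k : R) :
  measurable D -> mu.-integrable D (fun w => (g w)%:E) ->
  mu.-integrable D (fun w => (g w * k)%:E).
Proof.
move=> mD ig; have := integrableZr mD k ig.
by apply: eq_integrable => // w _; rewrite /= EFinM.
Qed.

(** * Weighted expectations of the Fejer kernel *)

Section fejer_expectation.
Context d (T : measurableType d) (R : realType) (P : probability T R) (m : nat).
Variable X : 'I_m -> {RV P >-> R}.
Hypothesis indepX : mutually_independent P (fun k => (X k : T -> R)).
Variables (A B : {set 'I_m}) (U S S' : T -> R) (c L : R).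
Hypothesis disjAB : forall i, i \in A -> i \notin B.
Hypotheses (mU : measurable_wrt X A U) (mS : measurable_wrt X A S).
Hypothesis mS' : measurable_wrt X B S'.
Hypotheses (iU : P.-integrable setT (EFin \o U)) (U0 : forall w, 0 <= U w).
Hypotheses (c0 : 0 < c) (L0 : 0 < L).
Hypothesis charS' : forall s,
  charRe P S' s ^+ 2 + charIm P S' s ^+ 2 <= (1 / (1 + c ^+ 2 * s ^+ 2)) ^+ 2.

Local Notation mu := (@lebesgue_measure R).
Let I : set R := `[0, L]%classic.
Let Z w := S w + S' w.
(** The Fejer weight extended by zero, so that Fubini is applied over the whole line. *)
Let k (s : R) := \1_I s * (1 - s / L).
Let r (s : R) := 1 / (1 + c ^+ 2 * s ^+ 2).
Let G (s : R) := \int[P]_w (U w * cos (s * Z w)).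

Let mI : measurable I. Proof. exact: measurable_itv. Qed.

Let mZ : measurable_fun [set: T] Z.
Proof.
by apply: measurable_funD; [exact: measurable_wrt_measurable mS|
                            exact: measurable_wrt_measurable mS'].
Qed.

Let k_ge0 s : 0 <= k s.
Proof.
rewrite /k indicE; case: (boolP (s \in I)) => [|_]; last by rewrite mul0r.
rewrite inE /I/= in_itv/= => /andP[_ sL].
by rewrite mul1r subr_ge0 ler_pdivrMr// mul1r.
Qed.

Let k_le s : k s <= \1_I s.
Proof.
rewrite /k indicE; case: (boolP (s \in I)) => [|_]; last by rewrite mul0r.
rewrite inE /I/= in_itv/= => /andP[s0 _].
by rewrite mul1r gerBl divr_ge0// ltW.
Qed.

Let integral_indicI (g : R -> R) :
  (\int[mu]_s (\1_I s * g s)%:E = \int[mu]_(s in I) (g s)%:E)%E.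
Proof.
rewrite [RHS]integral_mkcond; apply: eq_integral => s _.
by rewrite patchE indicE; case: ifP => _; rewrite ?mul1r ?mul0r.
Qed.

Let r_ge0 s : 0 <= r s.
Proof. by rewrite /r divr_ge0// addr_ge0// mulr_ge0 ?sqr_ge0. Qed.

Let G_le s : G s <= (\int[P]_w U w) * r s.
Proof.
rewrite /G /Z; have [-> _] := charfunD indepX s disjAB mU mS mS' iU.
set C := charRe P S' s; set D := charIm P S' s.
have mUR := measurable_wrt_measurable mU.
have iUc : P.-integrable setT (fun w => (U w * cos (s * S w))%:E).
  apply: integrableM_le1 => // [|w]; last exact: normr_cos_le1.
  exact: measurable_wrt_measurable (measurable_wrt_cos s mS).
have iUs : P.-integrable setT (fun w => (U w * sin (s * S w))%:E).
  apply: integrableM_le1 => // [|w]; last exact: normr_sin_le1.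
  exact: measurable_wrt_measurable (measurable_wrt_sin s mS).
have iUcC : P.-integrable setT (fun w => (U w * cos (s * S w) * C)%:E).
  exact: integrableZr_EFin.
have iUsD : P.-integrable setT (fun w => (U w * sin (s * S w) * D)%:E).
  exact: integrableZr_EFin.
rewrite -!RintegralZr// -RintegralB//.
apply: le_Rintegral => //.
- by have := integrableB measurableT iUcC iUsD; apply: eq_integrable.
- exact: integrableZr_EFin.
move=> w _; rewrite -!mulrA -mulrBr ler_wpM2l//.
have h := charS' s; rewrite -/C -/D -/(r s) in h.
(* Cauchy-Schwarz for the unit vector [(cos, sin)] against [(C, D)], in the form of Lagrange's
   identity; a negative value is trivially below [r s]. *)
have [h1|h0] := leP 0 (cos (s * S w) * C - sin (s * S w) * D); last first.
  exact: le_trans (ltW h0) (r_ge0 s).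
rewrite -(@ler_pXn2r _ 2)// ?nnegrE//; apply: le_trans h.
have := cos2Dsin2 (s * S w); have := sqr_ge0 (cos (s * S w) * D + sin (s * S w) * C).
move: (cos _) (sin _) => x y xy e.
have -> : C ^+ 2 + D ^+ 2 = (x ^+ 2 + y ^+ 2) * (C ^+ 2 + D ^+ 2) by rewrite e mul1r.
lra.
Qed.

Let iUcos s : P.-integrable setT (fun w => (U w * cos (s * Z w))%:E).
Proof.
apply: integrableM_le1 => // [|w]; last exact: normr_cos_le1.
apply: (@measurableT_comp _ _ _ _ _ _ cos); first exact: measurable_cos.
by apply: measurable_funM => //; exact: measurable_cst.
Qed.

Let G_norm s : `|G s| <= \int[P]_w U w.
Proof.
apply: le_trans (le_normr_Rintegral measurableT (iUcos s)) _.
apply: le_Rintegral => //; first exact: (integrable_norm (iUcos s)).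
by move=> w _; rewrite normrM (ger0_norm (U0 w)) ler_piMr// normr_cos_le1.
Qed.

Let f (p : T * R) : \bar R := (U p.1 * (k p.2 * cos (p.2 * Z p.1)))%:E.

Let mf : measurable_fun [set: T * R] f.
Proof.
have m1 (h : T -> R) : measurable_fun [set: T] h ->
  measurable_fun [set: T * R] (fun p => h p.1).
  by move=> mh; apply: measurableT_comp => //; exact: measurable_fst.
apply/measurable_EFinP; apply: measurable_funM.
  by apply: m1; exact: measurable_wrt_measurable mU.
apply: measurable_funM.
  have mk : measurable_fun [set: R] k.
    apply: measurable_funM; first exact: measurable_indic.
    apply: measurable_funB; first exact: measurable_cst.
    by apply: measurable_funM => //; exact: measurable_cst.
  by apply: (measurableT_comp mk); exact: measurable_snd.
apply: (@measurableT_comp _ _ _ _ _ _ cos); first exact: measurable_cos.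
apply: measurable_funM; first exact: measurable_snd.
exact: m1.
Qed.

Let intf : (P \x mu)%E.-integrable setT f.
Proof.
apply/integrable12ltyP => //.
have lam : mu I = L%:E.
  by rewrite /I lebesgue_measure_itv/= lte_fin L0 oppr0 adde0.
(* Tonelli: for fixed [w] the integrand is at most [U w] in absolute value and lives on an interval
   of length [L]. *)
apply: (@le_lt_trans _ _ (\int[P]_w ((U w)%:E * L%:E))%E).
  apply: ge0_le_integral => //.
  - by move=> w _; exact: integral_ge0.
  - have mfa : measurable_fun [set: T * R] (abse \o f) by exact: measurableT_comp.
    have := @measurable_fun_fubini_tonelli_F _ _ T (measurableTypeR R) R mu (abse \o f) mfa (fun=> abse_ge0 _).
    exact.
  - apply: emeasurable_funM => //; apply/measurable_EFinP.
    exact: measurable_wrt_measurable mU.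
  move=> w _; rewrite -lam.
  rewrite -[X in mu X]setIT -integral_indic// -ge0_integralZl//; last 2 first.
    - by apply/measurable_EFinP; exact: measurable_indic.
    - by rewrite lee_fin.
  apply: ge0_le_integral => //.
  - by apply: measurableT_comp => //; apply: measurableT_comp => //; exact: pair1_measurable.
  - apply: emeasurable_funM => //; apply/measurable_EFinP; exact: measurable_indic.
  move=> s _; rewrite /f/= lee_fin normrM (ger0_norm (U0 w)) ler_wpM2l//.
  rewrite normrM (ger0_norm (k_ge0 s)); apply: le_trans (k_le s).
  by rewrite ler_piMr// normr_cos_le1.
rewrite (integralZr measurableT iU).
rewrite -(fineK (integrable_fin_num measurableT iU)) -EFinM ltry//.
Qed.

Let EfE s : (\int[P]_w f (w, s) = (k s * G s)%:E)%E.
Proof.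
rewrite EFinM /G /Rintegral fineK; last exact: integrable_fin_num.
rewrite -integralZl//; apply: eq_integral => w _.
by rewrite /f/= -EFinM; congr EFin; ring.
Qed.

Let fejerUE w : (\int[mu]_s f (w, s) = (U w * fejer L (Z w))%:E)%E.
Proof.
rewrite EFinM -fejerE -integralZl//; last first.
  exact: (@integrable_continuous_segment R _ 0 L (@continuous_fejer R L (Z w))).
rewrite -/I -[RHS]/(\int[mu]_(s in I) (U w * ((1 - s / L) * cos (s * Z w)))%:E)%E.
rewrite -integral_indicI; apply: eq_integral => s _.
by rewrite /f/= /k; congr EFin; ring.
Qed.

(** Fubini turns the left side into the integral of [k s * G s], and [G] lies below the expectation
    of [U] times a Lorentzian. The resulting bound does not depend on [L], which the later limit
    relies on. *)
Lemma fejer_expectation_le :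
  (\int[P]_w (U w * fejer L (S w + S' w))%:E <=
   ((\int[P]_w U w) * (pi / (2 * c)))%:E)%E.
Proof.
have EU0 : 0 <= \int[P]_w U w by apply: Rintegral_ge0 => w _.
under eq_integral do rewrite -fejerUE.
rewrite (Fubini intf); under eq_integral do rewrite EfE.
have ikG : mu.-integrable setT (fun s => (k s * G s)%:E).
  have iI : mu.-integrable setT (fun s => (\1_I s * \int[P]_w U w)%:E).
    apply: integrableZr_EFin => //; exact: integrable_indic_itv.
  apply: (le_integrable measurableT _ _ iI).
    apply: eq_measurable_fun (measurable_fubini_G intf) => s _.
    exact: EfE.
  move=> s _; rewrite lee_fin normrM (ger0_norm (k_ge0 s)).
  by apply: le_trans (ler_norm _); apply: ler_pM.
have cr : continuous r.
  move=> s; rewrite /r; apply: cvgMr; apply: cvgV.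
    by rewrite gt_eqF// ltr_pwDl// mulr_ge0 ?sqr_ge0.
  apply: cvgD; first exact: cvg_cst.
  by apply: cvgMr; apply: (cvgM (f := id) (g := id)); exact: cvg_id.
have ir : mu.-integrable I (EFin \o r) := @integrable_continuous_segment R r 0 L cr.
have iEr : mu.-integrable setT (fun s => (\1_I s * ((\int[P]_w U w) * r s))%:E).
  have : mu.-integrable I (fun s => ((\int[P]_w U w) * r s)%:E).
    have := @integrableZr_EFin _ _ R mu I r (\int[P]_w U w) (measurable_itv _) ir.
    by apply: eq_integrable => // s _; rewrite mulrC.
  move=> h; have := (@integrable_mkcond _ (measurableTypeR R) R mu I _ (measurable_itv _)).1 h.
  apply: eq_integrable => // s _.
  by rewrite patchE indicE; case: ifP => _; rewrite ?mul1r ?mul0r.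
(* The order matters: [G] may be negative, so it is replaced by its nonnegative majorant before [k]
   is enlarged to the indicator. *)
apply: (@le_trans _ _ (\int[mu]_s (\1_I s * ((\int[P]_w U w) * r s))%:E)%E).
  apply: le_integral => // s _; rewrite lee_fin.
  apply: le_trans (_ : k s * ((\int[P]_w U w) * r s) <= _).
    by rewrite ler_wpM2l// G_le.
  by rewrite ler_wpM2r ?k_le// mulr_ge0.
rewrite integral_indicI; under eq_integral do rewrite EFinM.
rewrite integralZl// EFinM lee_wpmul2l ?lee_fin//.
exact: integral_oneDsqr_le.
Qed.

End fejer_expectation.

(** * Moments against the Fejer kernel *)

Lemma fejerE_neq0 (R : realType) (L x : R) : 0 < L -> x != 0 ->
  fejer L x = (1 - cos (L * x)) / (L * x ^+ 2).
Proof. by move=> L0 x0; rewrite /fejer integral_fejer. Qed.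

Lemma measurable_fejer (R : realType) (L : R) : 0 < L ->
  measurable_fun [set: R] (@fejer R L).
Proof.
move=> L0.
(* The inverse square is written as a real power so that measurability of [powR] applies; the origin
   is a separate branch. *)
have E : @fejer R L = (fun x => if x == 0 then fejer L 0 else
    (1 - cos (L * x)) * (L^-1 * (x ^+ 2) `^ (-1))).
  apply/funext => x; case: eqVneq => [->//|x0].
  by rewrite fejerE_neq0// powR_inv1 ?sqr_ge0// invfM.
rewrite E; apply: measurable_fun_ifT.
- by apply: measurable_fun_eqr => //; exact: measurable_cst.
- exact: measurable_cst.
- apply: measurable_funM.
    apply: measurable_funB; first exact: measurable_cst.
    apply: (@measurableT_comp _ _ _ _ _ _ cos); first exact: measurable_cos.
    by apply: measurable_funM => //; exact: measurable_cst.
  apply: measurable_funM; first exact: measurable_cst.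
  by apply: (@measurableT_comp _ _ _ _ _ _ (fun y : R => y `^ (-1))); [exact: measurable_powR|exact: measurable_funX].
Qed.

Lemma integrable_sqr_RV d (T : measurableType d) (R : realType)
    (P : probability T R) (X : {RV P >-> R}) :
  ('E_P[fun w => (X w ^+ 2)%R] = 1%E)%E ->
  P.-integrable setT (fun w => (X w ^+ 2)%:E).
Proof.
rewrite unlock => EX2.
apply/integrableP; split; first by apply/measurable_EFinP; exact: measurable_funX.
rewrite [X in (X < _)%E](_ : _ = 1%E) ?ltry//.
by rewrite -EX2; apply: eq_integral => w _; rewrite gee0_abs// lee_fin sqr_ge0.
Qed.

(** * Second moments of weighted sums *)

Section second_moment.
Context d (T : measurableType d) (R : realType) (P : probability T R) (m : nat).
Variable X : 'I_m -> {RV P >-> R}.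
Hypothesis indepX : mutually_independent P (fun k => (X k : T -> R)).
Hypothesis EX : (forall k, 'E_P[X k] = 0%E)%E.
Hypothesis EX2 : (forall k, 'E_P[fun w => (X k w ^+ 2)%R] = 1%E)%E.

Let integrable_sqr k : P.-integrable setT (fun w => (X k w ^+ 2)%:E).
Proof. exact: integrable_sqr_RV. Qed.

Lemma integrableX k : P.-integrable setT (fun w => (X k w)%:E).
Proof.
have i1 := finite_measure_integrable_cst P 1 measurableT.
have := integrableD measurableT i1 (integrable_sqr k).
apply: le_integrable => //; first exact/measurable_EFinP.
move=> w _; rewrite /= lee_fin [leRHS]ger0_norm ?addr_ge0 ?sqr_ge0//.
have := sqr_ge0 (`|X k w| - 1); have := normr_ge0 (X k w); have := real_normK (num_real (X k w)).
move: `|X k w| => y <- y0 h; nra.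
Qed.

Lemma integrableXX i j : P.-integrable setT (fun w => (X i w * X j w)%:E).
Proof.
have := integrableD measurableT (integrable_sqr i) (integrable_sqr j).
apply: le_integrable => //.
  by apply/measurable_EFinP; exact: measurable_funM.
move=> w _; rewrite /= lee_fin [leRHS]ger0_norm ?addr_ge0 ?sqr_ge0//.
have := sqr_ge0 (X i w - X j w); have := sqr_ge0 (X i w + X j w).
by move: (X i w) (X j w) => y z h1 h2; rewrite ler_norml; apply/andP; split; nra.
Qed.

Lemma RintegralXX i j : \int[P]_w (X i w * X j w) = (i == j)%:R.
Proof.
have [->|ij] := eqVneq i j.
  have := EX2 j; rewrite unlock /Rintegral => h.
  by rewrite -[RHS]/(fine 1%E) -h; congr fine.
have disj k : k \in [set i]%SET -> k \notin [set j]%SET.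
  by rewrite !inE => /eqP ->.
have mi : measurable_wrt X [set i]%SET (X i) by apply: measurable_wrtX; rewrite inE.
have mj : measurable_wrt X [set j]%SET (X j) by apply: measurable_wrtX; rewrite inE.
rewrite /Rintegral (expectationM indepX disj mi mj (integrableX i) (integrableX j) (integrableXX i j)).
by have := EX i; rewrite unlock => ->; rewrite mul0e.
Qed.

Lemma integrable_partial_sum (u : 'I_m -> R) (A : {set 'I_m}) :
  P.-integrable setT (fun w => (partial_sum X u A w)%:E).
Proof.
have : P.-integrable setT (fun w => \sum_(i in A) (X i w * u i)%:E)%E.
  by apply: integrable_sum => // i _; apply: integrableZr_EFin => //; exact: integrableX.
by apply: eq_integrable => // w _; rewrite sumEFin.
Qed.

Lemma sqr_partial_sum (u : 'I_m -> R) (A : {set 'I_m}) w :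
  partial_sum X u A w ^+ 2 = \sum_(i in A) \sum_(j in A) X i w * X j w * (u i * u j).
Proof.
rewrite expr2 /partial_sum big_distrl/=; apply: eq_bigr => i _.
by rewrite big_distrr/=; apply: eq_bigr => j _; ring.
Qed.

Lemma integrable_sqr_partial_sum (u : 'I_m -> R) (A : {set 'I_m}) :
  P.-integrable setT (fun w => (partial_sum X u A w ^+ 2)%:E).
Proof.
have : P.-integrable setT
    (fun w => \sum_(i in A) \sum_(j in A) (X i w * X j w * (u i * u j))%:E)%E.
  apply: integrable_sum => // i _; apply: integrable_sum => // j _.
  by apply: integrableZr_EFin => //; exact: integrableXX.
apply: eq_integrable => // w _; rewrite sqr_partial_sum -sumEFin.
by apply: eq_bigr => i _; rewrite sumEFin.
Qed.

Lemma Rintegral_sqr_partial_sum (u : 'I_m -> R) (A : {set 'I_m}) :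
  \int[P]_w (partial_sum X u A w ^+ 2) = \sum_(i in A) u i ^+ 2.
Proof.
have fineE : (\int[P]_w (partial_sum X u A w ^+ 2)%:E =
    \sum_(i in A) \sum_(j in A) ((i == j)%:R * (u i * u j))%:E)%E.
  transitivity (\int[P]_w \sum_(i in A) \sum_(j in A) (X i w * X j w * (u i * u j))%:E)%E.
    apply: eq_integral => w _; rewrite sqr_partial_sum -sumEFin.
    by apply: eq_bigr => i _; rewrite sumEFin.
  rewrite integral_sum//; last first.
    move=> i; apply: integrable_sum => // j _.
    by apply: integrableZr_EFin => //; exact: integrableXX.
  apply: eq_bigr => i _; rewrite integral_sum//; last first.
    by move=> j; apply: integrableZr_EFin => //; exact: integrableXX.
  apply: eq_bigr => j _; rewrite -RintegralXX -RintegralZr//; last exact: integrableXX.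
  rewrite /Rintegral fineK//; apply: integrable_fin_num => //.
  by apply: integrableZr_EFin => //; exact: integrableXX.
rewrite /Rintegral fineE.
under eq_bigr do rewrite sumEFin.
rewrite sumEFin/=; apply: eq_bigr => i iA.
rewrite (bigD1 i)//= eqxx mul1r big1 ?addr0 ?expr2// => j /andP[_ ji].
by rewrite eq_sym (negbTE ji) mul0r.
Qed.

Lemma Rintegral_norm_partial_sum_le (u : 'I_m -> R) (A : {set 'I_m}) :
  \int[P]_w `|partial_sum X u A w| <= Num.sqrt (\sum_(i in A) u i ^+ 2).
Proof.
set Y := partial_sum X u A; set mu := \int[P]_w _.
have mu0 : 0 <= mu by apply: Rintegral_ge0.
have iY : P.-integrable setT (fun w => `|Y w|%:E).
  exact: (integrable_norm (integrable_partial_sum u A)).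
have iYmu := integrableZr_EFin (2 * mu) measurableT iY.
(* Nonnegativity of the variance of [|Y|], which gives [mu ^+ 2 <= E[Y^2]]. *)
have h : 0 <= \int[P]_w ((Y w ^+ 2 - `|Y w| * (2 * mu)) + mu ^+ 2).
  apply: Rintegral_ge0 => w _; rewrite -(real_normK (num_real (Y w))).
  by rewrite (_ : _ + _ = (`|Y w| - mu) ^+ 2) ?sqr_ge0//; ring.
have imu := finite_measure_integrable_cst P (mu ^+ 2) measurableT.
have iB := integrableB measurableT (integrable_sqr_partial_sum u A) iYmu.
rewrite RintegralD// RintegralB// in h; last exact: integrable_sqr_partial_sum.
rewrite Rintegral_sqr_partial_sum RintegralZr// -/mu in h.
rewrite Rintegral_cst// in h.
have PT : fine (P [set: T]) = 1 by rewrite (@probability_setT _ _ _ P).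
rewrite [X in _ + _ * X](_ : _ = 1)// mulr1 in h.
rewrite -[leLHS]ger0_norm// -sqrtr_sqr ler_sqrt; last first.
  by apply: sumr_ge0 => i _; exact: sqr_ge0.
lra.
Qed.

End second_moment.

Lemma measurable_fun_norm d (T : measurableType d) (R : realType) (f : T -> R) :
  measurable_fun [set: T] f -> measurable_fun [set: T] (fun w => `|f w|).
Proof. by move=> mf; apply: measurableT_comp. Qed.

(** * The moment of [|Y|] localized near [X = 0] *)

Section kac_rice_moment.
Context d (T : measurableType d) (R : realType) (P : probability T R) (n : nat).
Variable X : 'I_n.+1 -> {RV P >-> R}.
Hypothesis indepX : mutually_independent P (fun k => (X k : T -> R)).
Hypothesis iidX : identically_distributed P (fun k => (X k : T -> R)).
Hypothesis EX : (forall k, 'E_P[X k] = 0%E)%E.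
Hypothesis EX2 : (forall k, 'E_P[fun w => (X k w ^+ 2)%R] = 1%E)%E.
Variables (a q : R).
Hypotheses (a0 : 0 < a) (q1 : 1 <= q).
Hypothesis char_le : forall s : R,
  cmod (charRe P (X ord0) s) (charIm P (X ord0) s) <= 1 / (1 + a * s ^+ 2) `^ q.

Let aq0 : 0 < a * q.
Proof. by rewrite mulr_gt0// (lt_le_trans _ q1). Qed.

Let saq0 : 0 < Num.sqrt (a * q).
Proof. by rewrite sqrtr_gt0. Qed.

Let mPS (u : 'I_n.+1 -> R) A : measurable_wrt X A (partial_sum X u A).
Proof. exact: measurable_wrt_sum. Qed.

Let mPS' (u : 'I_n.+1 -> R) A : measurable_fun [set: T] (partial_sum X u A).
Proof. exact: measurable_wrt_measurable (@mPS u A). Qed.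

Lemma partial_sumID (u : 'I_n.+1 -> R) (A : {set 'I_n.+1}) w :
  partial_sum X u A w + partial_sum X u (~: A) w = partial_sum X u [set: 'I_n.+1]%SET w.
Proof.
rewrite /partial_sum [RHS](bigID (mem A))/=; congr (_ + _).
  by apply: eq_bigl => i; rewrite !inE.
by apply: eq_bigl => i; rewrite !inE.
Qed.

Lemma fejer_weighted_le (u : 'I_n.+1 -> R) (A : {set 'I_n.+1}) (U : T -> R) (L : R) :
  measurable_wrt X A U -> P.-integrable setT (EFin \o U) -> (forall w, 0 <= U w) ->
  0 < L -> 0 < \sum_(i in ~: A) u i ^+ 2 ->
  (\int[P]_w (U w * fejer L (partial_sum X u [set: 'I_n.+1]%SET w))%:E <=
   ((\int[P]_w U w) *
    (pi / (2 * (Num.sqrt (a * q) * Num.sqrt (\sum_(i in ~: A) u i ^+ 2)))))%:E)%E.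
Proof.
move=> mU iU U0 L0 W0.
have W1 : 0 < Num.sqrt (\sum_(i in ~: A) u i ^+ 2) by rewrite sqrtr_gt0.
under eq_integral do rewrite -(partial_sumID u A).
apply: (fejer_expectation_le indepX (A := A) (B := (~: A)%SET)) => //.
- by move=> i iA; rewrite inE negbK.
- by rewrite mulr_gt0.
- move=> s; apply: le_trans (charfun_partial_sum_le indepX iidX a0 q1 char_le u (~: A)%SET s) _.
  have -> : (Num.sqrt (a * q) * Num.sqrt (\sum_(i in ~: A) u i ^+ 2)) ^+ 2 =
      a * q * \sum_(i in ~: A) u i ^+ 2.
    by rewrite exprMn !sqr_sqrtr ?(ltW aq0) ?(ltW W0).
  by rewrite mulrAC.
Qed.

(** Here [r] plays the role of [|v_A| / |u_B|] without a division: if [u] vanishes off [A], the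
    hypothesis forces [v = 0] on [A] and the left side is 0. *)
Lemma fejer_norm_partial_sum_le (u v : 'I_n.+1 -> R) (A : {set 'I_n.+1}) (r L : R) :
  0 < L -> 0 <= r ->
  \sum_(i in A) v i ^+ 2 <= r ^+ 2 * \sum_(i in ~: A) u i ^+ 2 ->
  (\int[P]_w (`|partial_sum X v A w| * fejer L (partial_sum X u [set: 'I_n.+1]%SET w))%:E <=
   (r * (pi / (2 * Num.sqrt (a * q))))%:E)%E.
Proof.
move=> L0 r0 vu.
have W0 : 0 <= \sum_(i in ~: A) u i ^+ 2 by apply: sumr_ge0 => i _; exact: sqr_ge0.
have [W|W] := ltP 0 (\sum_(i in ~: A) u i ^+ 2); last first.
  have v0 : forall i, i \in A -> v i = 0.
    move=> i iA; apply/eqP; rewrite -sqrf_eq0; apply/eqP.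
    apply: (psumr_eq0P (P := mem A) (F := fun i => v i ^+ 2)) => //.
      by move=> *; exact: sqr_ge0.
    apply/eqP; rewrite eq_le sumr_ge0 ?andbT; last by move=> *; exact: sqr_ge0.
    by apply: (le_trans vu); rewrite mulr_ge0_le0 ?sqr_ge0.
  under eq_integral => w _.
    rewrite (_ : partial_sum X v A w = 0); last first.
      by rewrite /partial_sum big1// => i iA; rewrite v0// mulr0.
    rewrite normr0 mul0r.
    over.
  by rewrite integral0 lee_fin mulr_ge0// divr_ge0 ?pi_ge0// mulr_ge0// ltW.
have W1 : 0 < Num.sqrt (\sum_(i in ~: A) u i ^+ 2) by rewrite sqrtr_gt0.
apply: le_trans (@fejer_weighted_le u A (fun w => `|partial_sum X v A w|) L _ _ _ L0 W) _ => //.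
- by apply: measurable_fun_norm; exact: mPS.
- exact: (integrable_norm (integrable_partial_sum EX2 v A)).
rewrite lee_fin.
have -> : r * (pi / (2 * Num.sqrt (a * q))) =
    (r * Num.sqrt (\sum_(i in ~: A) u i ^+ 2)) *
    (pi / (2 * (Num.sqrt (a * q) * Num.sqrt (\sum_(i in ~: A) u i ^+ 2)))).
  by field; rewrite !gt_eqF.
rewrite ler_wpM2r//.
  by rewrite divr_ge0 ?pi_ge0// mulr_ge0// mulr_ge0// ltW.
apply: le_trans (Rintegral_norm_partial_sum_le indepX EX EX2 v A) _.
by rewrite -[leRHS]ger0_norm ?mulr_ge0 ?sqrtr_ge0// -sqrtr_sqr ler_wsqrtr// exprMn sqr_sqrtr.
Qed.

(** A nonnegative function below the Fejer kernel, supported at scale [1 / L]. The kernel itself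
    decays only like [1 / x ^+ 2], too slowly to absorb the factor [|x|] coming from the part of [Y]
    parallel to [X]. *)
Definition window (L x : R) : R := Num.max 0 (fejer_minorant L x).

Lemma window_ge0 L x : 0 <= window L x.
Proof. by rewrite /window le_max lexx. Qed.

Lemma window_le L x : 0 < L -> window L x <= fejer L x.
Proof. by move=> L0; rewrite /window ge_max fejer_ge0// fejer_ge. Qed.

Lemma window_support L x : 0 < L -> `|x| * window L x <= (4 / L) * fejer L x.
Proof.
move=> L0; apply: (@le_trans _ _ ((4 / L) * window L x)); last first.
  by rewrite ler_wpM2l ?window_le// divr_ge0// ltW.
have [xL|xL] := leP `|x| (4 / L); first by rewrite ler_wpM2r// window_ge0.
suff -> : window L x = 0 by rewrite !mulr0.
apply/max_idPl; rewrite /fejer_minorant.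
(* The minorant changes sign at [|L * x| = sqrt 12]; the radius 4 is a convenient number beyond
   it. *)
have : 12 <= (L * x) ^+ 2.
  rewrite -(real_normK (num_real (L * x))) normrM (gtr0_norm L0).
  have : 4 < L * `|x| by rewrite mulrC -ltr_pdivrMr.
  move: (L * _) => y y4; nra.
move=> h; have -> : L / 2 - L ^+ 3 * x ^+ 2 / 24 = L * (12 - (L * x) ^+ 2) / 24.
  by rewrite exprMn; field.
by rewrite pmulr_lle0 ?invr_gt0// pmulr_rle0// subr_le0.
Qed.

Lemma measurable_window L : measurable_fun [set: R] (window L).
Proof.
apply: measurable_maxr; first exact: measurable_cst.
apply: measurable_funB; first exact: measurable_cst.
apply: measurable_funM; last exact: measurable_cst.
by apply: measurable_funM; [exact: measurable_cst|exact: measurable_funX].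
Qed.

Variables u v : 'I_n.+1 -> R.
Let K := \sum_k u k ^+ 2.
Let N := \sum_k u k * v k.
Let V := \sum_k v k ^+ 2.
Let kappa := Num.sqrt (V * K - N ^+ 2) / K.
Hypothesis K0 : 0 < K.
Hypothesis D0 : 0 < V * K - N ^+ 2.

(** [Y] is written as [Y'_A + Y'_B + (N / K) X]. The halves take the Fejer bound with [A] and its
    complement exchanged; by [window_support] the last term costs [4 / L] times an expectation
    bounded uniformly in [L]. *)
Lemma window_moment_le (L : R) : 0 < L ->
  (\int[P]_w (`|partial_sum X v [set: 'I_n.+1]%SET w| *
     window L (partial_sum X u [set: 'I_n.+1]%SET w))%:E <=
   (((1 + Num.sqrt 3) * kappa + `|N / K| * (4 / L) / Num.sqrt K) *
     (pi / (2 * Num.sqrt (a * q))))%:E)%E.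
Proof.
move=> L0.
pose v' k := v k - N / K * u k.
have uv' : \sum_k u k * v' k = 0.
  rewrite (eq_bigr (fun k => u k * v k - N / K * u k ^+ 2)); last first.
    by move=> k _; rewrite /v'; ring.
  by rewrite sumrB -big_distrr/= -/N -/K divfK ?gt_eqF// subrr.
(* Pythagoras: [|v'|^2 = V - N^2 / K], so [kappa] is the ratio [|v'| / |u|]. *)
have vv' : \sum_k v' k ^+ 2 = kappa ^+ 2 * K.
  rewrite (eq_bigr (fun k => v k ^+ 2 - 2 * (N / K) * (u k * v k) + (N / K) ^+ 2 * u k ^+ 2)); last first.
    by move=> k _; rewrite /v'; ring.
  rewrite big_split sumrB/= -!big_distrr/= -/N -/K -/V.
  have -> : kappa ^+ 2 = (V * K - N ^+ 2) / K ^+ 2.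
    by rewrite /kappa expr_div_n sqr_sqrtr ?ltW.
  by field; rewrite gt_eqF.
have kappa0 : 0 <= kappa by rewrite divr_ge0 ?sqrtr_ge0// ltW.
have [A [r1 [r2 [r10 r20 h1 h2 h12]]]] := balanced_split uv' K0 kappa0 vv'.
set S := partial_sum X u [set: 'I_n.+1]%SET.
have F1 := fejer_norm_partial_sum_le L0 r10 h1.
rewrite -{2}(finset.setCK A) in h2.
have F2 := fejer_norm_partial_sum_le L0 r20 h2.
(* Empty set and weight 1: the complement is everything, so this bounds the plain expectation of the
   Fejer kernel at [X]. *)
have F3 := @fejer_weighted_le u finset.set0 (cst 1) L (measurable_cst _)
   (finite_measure_integrable_cst P 1 measurableT) (fun=> ler01) L0.
rewrite finset.setC0 in F3.
have KE : \sum_(i in [set: 'I_n.+1]%SET) u i ^+ 2 = K.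
  by apply: eq_bigl => i; rewrite inE.
rewrite KE Rintegral_cst// in F3; move: (F3 K0) => {}F3.
rewrite -/S in F1 F2 F3.
have mS : measurable_fun [set: T] S by exact: mPS'.
have mfS : measurable_fun [set: T] (fun w => fejer L (S w)).
  exact: (measurableT_comp (measurable_fejer L0)).
have mN B : measurable_fun [set: T] (fun w => `|partial_sum X v' B w|).
  by apply: measurable_fun_norm; exact: mPS'.
have f0 w : 0 <= fejer L (S w) by exact: fejer_ge0.
pose g1 w := `|partial_sum X v' A w| * fejer L (S w).
pose g2 w := `|partial_sum X v' (~: A)%SET w| * fejer L (S w).
pose c := `|N / K| * (4 / L).
have c0 : 0 <= c by rewrite /c mulr_ge0// divr_ge0// ltW.
have mg1 : measurable_fun [set: T] g1 by exact: measurable_funM.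
have mg2 : measurable_fun [set: T] g2 by exact: measurable_funM.
apply: (@le_trans _ _ (\int[P]_w ((g1 w)%:E + (g2 w)%:E + (c%:E * (1 * fejer L (S w))%:E)))%E).
  apply: ge0_le_integral => //.
  - by move=> w _; rewrite lee_fin mulr_ge0// window_ge0.
  - apply/measurable_EFinP; apply: measurable_funM.
      by apply: measurable_fun_norm; exact: mPS'.
    exact: (measurableT_comp (@measurable_window L)).
  - apply: emeasurable_funD.
      by apply: emeasurable_funD; exact/measurable_EFinP.
    apply: emeasurable_funM; first exact: measurable_cst.
    by apply/measurable_EFinP; apply: measurable_funM => //; exact: measurable_cst.
  move=> w _; rewrite mul1r -EFinM -!EFinD lee_fin /g1 /g2.
  have -> : partial_sum X v [set: 'I_n.+1]%SET w =
      partial_sum X v' A w + partial_sum X v' (~: A)%SET w + N / K * S w.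
    rewrite partial_sumID /S /partial_sum big_distrr/= -big_split/=.
    by apply: eq_bigr => i _; rewrite /v'; ring.
  have wS := window_support (S w) L0; have wf := window_le (S w) L0.
  have w0 := window_ge0 L (S w).
  apply: (@le_trans _ _ ((`|partial_sum X v' A w| + `|partial_sum X v' (~: A)%SET w| +
      `|N / K| * `|S w|) * window L (S w))).
    rewrite ler_wpM2r// -normrM; apply: le_trans (ler_normD _ _) _.
    by rewrite lerD2r ler_normD.
  rewrite !mulrDl; apply: lerD; first by apply: lerD; rewrite ler_wpM2l.
  by rewrite /c -!mulrA ler_wpM2l// !mulrA.
rewrite ge0_integralD//; last 4 first.
- by move=> w _; rewrite adde_ge0// lee_fin mulr_ge0.
- by apply: emeasurable_funD; exact/measurable_EFinP.
- by move=> w _; rewrite mule_ge0// lee_fin mulr_ge0.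
- apply: emeasurable_funM; first exact: measurable_cst.
  by apply/measurable_EFinP; apply: measurable_funM => //; exact: measurable_cst.
rewrite ge0_integralD//; last 4 first.
- by move=> w _; rewrite lee_fin mulr_ge0.
- exact/measurable_EFinP.
- by move=> w _; rewrite lee_fin mulr_ge0.
- exact/measurable_EFinP.
rewrite ge0_integralZl_EFin//; last 2 first.
- by move=> w _; rewrite lee_fin mulr_ge0.
- by apply/measurable_EFinP; apply: measurable_funM => //; exact: measurable_cst.
have PT : fine (P [set: T]) = 1 by rewrite (@probability_setT _ _ _ P).
apply: le_trans (leeD (leeD F1 F2) (lee_wpmul2l _ F3)) _; first by rewrite lee_fin.
rewrite -EFinM -!EFinD lee_fin [X in 1 * X](_ : _ = 1)// !mul1r.
have sK0 : 0 < Num.sqrt K by rewrite sqrtr_gt0.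
have -> : c * (pi / (2 * (Num.sqrt (a * q) * Num.sqrt K))) =
    c / Num.sqrt K * (pi / (2 * Num.sqrt (a * q))).
  by field; rewrite !gt_eqF.
rewrite -!mulrDl ler_wpM2r//.
  by rewrite divr_ge0 ?pi_ge0// mulr_ge0// ltW.
by rewrite lerD2r.
Qed.

End kac_rice_moment.

(** * Densities and the limit *)

Section integral_density.
Local Open Scope ereal_scope.
Context d (T : measurableType d) (R : realType).
Variables (mu nu : {measure set T -> \bar R}) (g : T -> R).
Hypotheses (mg : measurable_fun [set: T] g) (g0 : forall x, (0 <= g x)%R).
Hypothesis nuE : forall A, measurable A -> nu A = \int[mu]_(x in A) (g x)%:E.

Import HBNNSimple.

Lemma integral_density_nnsfun (h : {nnsfun T >-> R}) :
  \int[nu]_x (h x)%:E = \int[mu]_x ((h x)%:E * (g x)%:E).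
Proof.
have mpre y : measurable (h @^-1` [set y]) by exact: measurable_sfunP.
have mind y : measurable_fun [set: T] (fun x => (\1_(h @^-1` [set y]) x : R)).
  exact: measurable_indic.
transitivity (\int[nu]_x \sum_(y \in range h) (y * \1_(h @^-1` [set y]) x)%:E).
  by apply: eq_integral => x _; rewrite fsumEFin// -fimfunE.
rewrite ge0_integral_fsum//; last 2 first.
- by move=> y; apply/measurable_EFinP; exact: measurable_funM.
- by move=> y x _; exact: nnfun_muleindic_ge0.
transitivity (\int[mu]_x \sum_(y \in range h)
    ((y * \1_(h @^-1` [set y]) x)%:E * (g x)%:E)); last first.
  apply: eq_integral => x _; rewrite -ge0_mule_fsuml; last first.
    by move=> y; exact: nnfun_muleindic_ge0.
  by rewrite fsumEFin// -fimfunE.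
rewrite ge0_integral_fsum//; last 2 first.
- move=> y; apply: emeasurable_funM; apply/measurable_EFinP => //.
  exact: measurable_funM.
- by move=> y x _; rewrite mule_ge0 ?nnfun_muleindic_ge0// lee_fin.
apply: eq_fsbigr => y; rewrite inE => -[t _ hty].
have y0 : (0 <= y)%R by rewrite -hty.
transitivity (y%:E * nu (h @^-1` [set y])).
  under eq_integral do rewrite EFinM.
  rewrite ge0_integralZl_EFin//; last exact/measurable_EFinP.
  by rewrite integral_indic// setIT.
transitivity (y%:E * \int[mu]_x ((\1_(h @^-1` [set y]) x)%:E * (g x)%:E)).
  congr (_ * _); rewrite nuE// integral_mkcond; apply: eq_integral => x _.
  by rewrite patchE indicE; case: ifP => _; rewrite ?mul1e ?mul0e.
rewrite -ge0_integralZl_EFin//.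
- by apply: eq_integral => x _; rewrite EFinM muleA.
- by move=> x _; rewrite mule_ge0// lee_fin.
- by apply: emeasurable_funM; exact/measurable_EFinP.
Qed.

Lemma ge0_integral_density (h : T -> R) : measurable_fun [set: T] h ->
  (forall x, (0 <= h x)%R) ->
  \int[nu]_x (h x)%:E = \int[mu]_x ((h x)%:E * (g x)%:E).
Proof.
move=> mh h0.
have mhE : measurable_fun [set: T] (EFin \o h) by exact/measurable_EFinP.
pose s := nnsfun_approx measurableT mhE.
have cvg_s x : (s n x)%:E @[n --> \oo] --> (h x)%:E.
  by apply: cvg_nnsfun_approx => // y _; rewrite lee_fin.
have s_nd x m n : (m <= n)%N -> (s m x <= s n x)%R.
  by move=> mn; exact/lefP/nd_nnsfun_approx.
have cvg_nu : \int[nu]_x (s n x)%:E @[n --> \oo] --> \int[nu]_x (h x)%:E.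
  rewrite (eq_integral (fun x => limn (fun n => (s n x)%:E))); last first.
    by move=> x _; apply/esym/cvg_lim.
  apply: cvg_monotone_convergence => //.
  - by move=> n; apply/measurable_EFinP.
  - by move=> n x _; rewrite lee_fin.
  - by move=> x _ m n mn; rewrite lee_fin s_nd.
have cvg_mu : \int[mu]_x ((s n x)%:E * (g x)%:E) @[n --> \oo] -->
    \int[mu]_x ((h x)%:E * (g x)%:E).
  rewrite (eq_integral (fun x => limn (fun n => (s n x)%:E * (g x)%:E))); last first.
    by move=> x _; apply/esym/cvg_lim => //; exact: cvgeZr.
  apply: cvg_monotone_convergence => //.
  - by move=> n; apply: emeasurable_funM; exact/measurable_EFinP.
  - by move=> n x _; rewrite mule_ge0// lee_fin.
  - by move=> x _ m n mn; rewrite lee_wpmul2r ?lee_fin ?s_nd.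
apply: (cvg_unique _ cvg_nu) => //.
rewrite (_ : (fun n => _) = (fun n => \int[mu]_x ((s n x)%:E * (g x)%:E)))//.
by apply/funext => n; exact: integral_density_nnsfun.
Qed.

End integral_density.

(** Matches the product topology, in which [D] is continuous, with the product sigma-algebra: an
    open set is a countable union of squares with rational centres and radii [1 / (k + 1)]. *)
Lemma open_measurable_prod (R : realType) (U : set (R * R)) :
  open U -> measurable U.
Proof.
move=> oU.
pose Q : set (rat * rat * nat) := [set t | forall x y : R,
  `|x - ratr t.1.1| < t.2.+1%:R^-1 -> `|y - ratr t.1.2| < t.2.+1%:R^-1 -> U (x, y)].
pose box (t : rat * rat * nat) : set (R * R) :=
  ball (ratr t.1.1 : R) t.2.+1%:R^-1 `*` ball (ratr t.1.2 : R) t.2.+1%:R^-1.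
have -> : U = \bigcup_(t in Q) box t.
  apply/seteqP; split => [[x y] Uxy|[x y] [t Qt [/= bx by_]]]; last first.
    by apply: Qt; rewrite distrC; move: bx by_; rewrite /ball/=.
  have /nbhs_ballP[e /= e0 eU] := oU _ Uxy.
  (* Half of [e], because passing through the rational centre costs the radius twice. *)
  have [k ke] : exists k, k.+1%:R^-1 < e / 2.
    have := @ltr_add_invr R 0 (e / 2); rewrite divr_gt0// => /(_ isT)[k].
    by rewrite add0r => ?; exists k.
  have ii : k.+1%:R^-1 + k.+1%:R^-1 < e by rewrite (splitr e) ltrD.
  have near_rat (i z : R) : 0 < i -> exists r : rat, `|z - ratr r| < i.
    move=> i0; have zi : z - i < z + i by lra.
    have [r] := rat_in_itvoo zi; rewrite in_itv/= => /andP[h1 h2]; exists r.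
    by rewrite ltr_norml; apply/andP; split; lra.
  have k0 : 0 < k.+1%:R^-1 :> R by rewrite invr_gt0.
  have [r1 hr1] := near_rat _ x k0; have [r2 hr2] := near_rat _ y k0.
  exists (r1, r2, k); last by split; rewrite /ball/= distrC.
  move=> x' y' /= hx hy; apply: eU; split; rewrite /ball/=.
    have -> : x - x' = (x - ratr r1) - (x' - ratr r1) by ring.
    exact: le_lt_trans (ler_normB _ _) (lt_trans (ltrD hr1 hx) ii).
  have -> : y - y' = (y - ratr r2) - (y' - ratr r2) by ring.
  exact: le_lt_trans (ler_normB _ _) (lt_trans (ltrD hr2 hy) ii).
rewrite bigcup_mkcond; apply: countable_bigcupT_measurable => [|t].
  exact: countableP.
case: ifP => // _; apply: measurableX; exact: measurable_ball.
Qed.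

Lemma continuous_measurable_prod (R : realType) (f : R * R -> R) :
  continuous f -> measurable_fun [set: R * R] f.
Proof.
move=> cf; apply: (measurability _ (RGenOpens.measurableE R)) => _ [_ [a [b ->] <-]].
rewrite setTI; apply: open_measurable_prod; apply: open_comp => //.
Qed.

Section limn_einf_bounds.
Local Open Scope ereal_scope.
Context (R : realType).
Implicit Type u : (\bar R)^nat.

Lemma limn_einf_ge_near u c N : (forall n, (N <= n)%N -> c <= u n) -> c <= limn_einf u.
Proof.
move=> cu; rewrite limn_einf_lim (cvg_lim _ (@cvg_einfs_sup _ u))//.
apply: (@le_trans _ _ (einfs u N)); last by apply: ereal_sup_ubound; exists N.
by apply: le_ereal_inf_tmp => _ [n /= Nn <-]; exact: cu.
Qed.

Lemma limn_einf_le_cvg u w l : (forall n, u n <= w n) -> w @ \oo --> l -> limn_einf u <= l.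
Proof.
move=> uw wl; rewrite limn_einf_lim -(cvg_lim _ wl)//; apply: lee_lim.
- exact: is_cvg_einfs.
- by apply/cvg_ex; exists l.
apply: nearW => n; apply: le_trans (uw n).
by apply: ereal_inf_lbound; exists n => //=.
Qed.

End limn_einf_bounds.

Section joint_density.
Context d (T : measurableType d) (R : realType) (P : probability T R).
Variables (X Y : T -> R) (D : R -> R -> R).
Hypotheses (mX : measurable_fun [set: T] X) (mY : measurable_fun [set: T] Y).
Hypothesis densD : is_joint_density P X Y D.
Hypothesis contD : continuous (fun p : R * R => D p.1 p.2).

Local Notation mu := (@lebesgue_measure R).
Let mu2 := (mu \x mu)%E.
Let Dp (p : R * R) : R := Num.max 0 (D p.1 p.2).
Let f (p : R * R) : \bar R := (D p.1 p.2)%:E.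

Let mD : measurable_fun [set: R * R] (fun p : R * R => D p.1 p.2).
Proof. exact: continuous_measurable_prod. Qed.

Let mDp : measurable_fun [set: R * R] Dp.
Proof. by apply: measurable_maxr => //; exact: measurable_cst. Qed.

Let Dp_ge0 p : 0 <= Dp p. Proof. by rewrite /Dp le_max lexx. Qed.

Let fposE p : (f^\+ p = (Dp p)%:E)%E.
Proof. by rewrite funeposE /f /Dp maxC EFin_max. Qed.

(** [D] carries no sign condition. On [N = {D < 0}] the density identity makes a probability equal
    to minus the integral of the negative part, so both vanish and [D] may be replaced by its
    positive part. *)
Lemma joint_density_pos A : measurable A ->
  P ((fun w => (X w, Y w)) @^-1` A) = (\int[mu2]_(p in A) (Dp p)%:E)%E.
Proof.
pose N : set (R * R) := [set p | D p.1 p.2 < 0].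
have mN : measurable N.
  rewrite (_ : N = (fun p : R * R => D p.1 p.2) @^-1` `]-oo, 0[%classic).
    by rewrite -[X in measurable X]setTI; exact: mD.
  by apply/seteqP; split => p /=; rewrite in_itv.
have mfn : measurable_fun [set: R * R] (f^\-)%E.
  by apply: measurable_funeneg; exact/measurable_EFinP.
have dE A' : measurable A' -> P ((fun w => (X w, Y w)) @^-1` A') =
    (\int[mu2]_(p in A') (Dp p)%:E - \int[mu2]_(p in A') f^\- p)%E.
  move=> mA'; rewrite densD// integralE; congr (_ - _)%E.
  by apply: eq_integral => p _; exact: fposE.
have N0 : (\int[mu2]_(p in N) f^\- p = 0)%E.
  have := dE _ mN; rewrite [X in (X - _)%E]integral0_eq; last first.
    move=> p /= /ltW pN; congr EFin; rewrite /Dp; exact/max_idPl.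
  rewrite add0e => h; apply/eqP; rewrite eq_le; apply/andP; split.
    by rewrite -oppe_ge0 -h measure_ge0.
  by apply: integral_ge0 => p _; exact: funeneg_ge0.
move=> mA; rewrite dE// (_ : (\int[mu2]_(p in A) f^\- p = 0)%E) ?sube0//.
apply/eqP; rewrite eq_le; apply/andP; split; last first.
  by apply: integral_ge0 => p _; exact: funeneg_ge0.
rewrite -N0 [leLHS]integral_mkcond [leRHS]integral_mkcond.
apply: ge0_le_integral => //.
- by move=> p _; apply: erestrict_ge0 => q _; exact: funeneg_ge0.
- by apply/(measurable_restrictT _ _).1 => //; exact: measurable_funTS.
- by apply/(measurable_restrictT _ _).1 => //; exact: measurable_funTS.
move=> p _; rewrite !patchE.
have [pN|pN] := boolP (p \in N); first by case: ifP => // _; exact: funeneg_ge0.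
case: ifP => // _; rewrite funenegE /f -EFinN -EFin_max lee_fin ge_max lexx andbT.
rewrite oppr_le0 leNgt; apply: contra pN => ?; exact: mem_set.
Qed.

Lemma integral_joint_density (h : R * R -> R) : measurable_fun [set: R * R] h ->
  (forall p, 0 <= h p) ->
  (\int[mu2]_p (h p * Dp p)%:E = \int[P]_w (h (X w, Y w))%:E)%E.
Proof.
move=> mh h0.
have mXY : @measurable_fun _ _ T (measurableTypeR R * measurableTypeR R)%type setT
    (fun w => (X w, Y w)) by exact: measurable_fun_pair.
pose XY : {mfun T >-> (measurableTypeR R * measurableTypeR R)%type} :=
  HB.pack (fun w => (X w, Y w)) (isMeasurableFun.Build _ _ _ _ _ mXY).
have := @ge0_integral_density _ _ R mu2 (distribution P XY) Dp mDp Dp_ge0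
  joint_density_pos h mh h0.
rewrite ge0_integral_distribution//; last exact/measurable_EFinP.
Qed.

End joint_density.

(** * Passage to the limit [L -> oo] *)

Section kac_rice_fatou.
Context d (T : measurableType d) (R : realType) (P : probability T R).
Variables (X Y : T -> R) (D : R -> R -> R).
Hypotheses (mX : measurable_fun [set: T] X) (mY : measurable_fun [set: T] Y).
Hypothesis densD : is_joint_density P X Y D.
Hypothesis contD : continuous (fun p : R * R => D p.1 p.2).

Local Notation mu := (@lebesgue_measure R).
Let Dp (p : R * R) : R := Num.max 0 (D p.1 p.2).
Let Dp_ge0 p : 0 <= Dp p. Proof. by rewrite /Dp le_max lexx. Qed.
Let mDp : measurable_fun [set: R * R] Dp.
Proof.
by apply: measurable_maxr; [exact: measurable_cst|exact: continuous_measurable_prod].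
Qed.

Let G (L y : R) : \bar R := (\int[mu]_x (`|y| * window L x * Dp (x, y))%:E)%E.

Let G_ge0 L y : (0 <= G L y)%E.
Proof.
by apply: integral_ge0 => x _; rewrite lee_fin !mulr_ge0// ?window_ge0.
Qed.

Let mh (L : R) : measurable_fun [set: R * R] (fun p : R * R => `|p.2| * window L p.1).
Proof.
apply: measurable_funM.
  by apply: measurable_fun_norm; exact: measurable_snd.
exact: (measurableT_comp (@measurable_window _ L)).
Qed.

Let mf (L : R) : measurable_fun [set: R * R]
  (fun p : R * R => (`|p.2| * window L p.1 * Dp p)%:E).
Proof. by apply/measurable_EFinP; apply: measurable_funM => //; exact: mh. Qed.

Let f_ge0 (L : R) (p : R * R) : (0 <= (`|p.2| * window L p.1 * Dp p)%:E)%E.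
Proof. by rewrite lee_fin !mulr_ge0// ?window_ge0. Qed.

Let mG L : measurable_fun [set: R] (G L).
Proof.
exact: (@measurable_fun_fubini_tonelli_G _ _ (measurableTypeR R) (measurableTypeR R) R mu
  _ (@mf L) (@f_ge0 L)).
Qed.

Let integral_G L : (\int[mu]_y G L y = \int[P]_w (`|Y w| * window L (X w))%:E)%E.
Proof.
rewrite -(integral_joint_density mX mY densD contD (h := fun p => `|p.2| * window L p.1))//.
  by rewrite (@fubini_tonelli2 _ _ (measurableTypeR R) (measurableTypeR R) R mu mu _ (@mf L) (@f_ge0 L)).
by move=> p; rewrite mulr_ge0// window_ge0.
Qed.

(** In the variable [L * x], 3 is a simple radius below the sign change at [sqrt 12]. The mass 9/4
    is free of [L] and close to the full mass [4 / sqrt 3] of the window. *)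
Lemma integral_fejer_minorant (L : R) : 0 < L ->
  (\int[mu]_(x in `[(- (3 / L))%R, (3 / L)%R]) (fejer_minorant L x)%:E = (9 / 4)%:E)%E.
Proof.
move=> L0.
have LL : - (3 / L) < 3 / L by rewrite gtrN// divr_gt0.
have dF (x : R) : is_derive x 1 (fun x => L / 2 * x - L ^+ 3 / 72 * x ^+ 3) (fejer_minorant L x).
  by apply: is_derive_eq; rewrite /fejer_minorant /GRing.scale/=; field.
rewrite (integral_is_derive LL dF); last first.
  move=> x; apply: cvgB; first exact: cvg_cst.
  apply: cvgMl; apply: cvgMr.
  by apply: (cvgM (f := id) (g := id)); exact: cvg_id.
by congr EFin; field; rewrite gt_eqF.
Qed.

Lemma fejer_minorant_ge0 (L x : R) : 0 < L -> `|x| <= 3 / L -> 0 <= fejer_minorant L x.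
Proof.
move=> L0 xL; rewrite /fejer_minorant.
have : (L * x) ^+ 2 <= 9.
  rewrite -(real_normK (num_real (L * x))) normrM (gtr0_norm L0).
  have : L * `|x| <= 3 by rewrite mulrC -ler_pdivlMr.
  have : 0 <= L * `|x| by rewrite mulr_ge0// ltW.
  move: (L * _) => y y0 y3; nra.
move=> h; have -> : L / 2 - L ^+ 3 * x ^+ 2 / 24 = L * (12 - (L * x) ^+ 2) / 24.
  by rewrite exprMn; field.
by rewrite divr_ge0// mulr_ge0//; [exact: ltW|lra].
Qed.

Let G_ge (y t del L : R) : 0 < L -> 3 / L < del ->
  (forall x, `|x| < del -> t <= Dp (x, y)) -> (((`|y| * t) * (9 / 4))%:E <= G L y)%E.
Proof.
move=> L0 Ldel tD.
have [t0|t0] := ltP t 0.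
  apply: le_trans (G_ge0 L y); rewrite lee_fin mulr_le0_ge0//.
  by rewrite mulr_ge0_le0// ltW.
rewrite EFinM -(integral_fejer_minorant L0).
have yt0 : 0 <= `|y| * t by rewrite mulr_ge0.
have inI x : x \in `[(- (3 / L)), (3 / L)] -> `|x| <= 3 / L.
  by rewrite in_itv/= ler_norml.
rewrite -ge0_integralZl_EFin//; last 2 first.
- by move=> x /= /inI xI; rewrite lee_fin fejer_minorant_ge0.
- apply/measurable_EFinP; apply: measurable_funTS.
  apply: measurable_funB; first exact: measurable_cst.
  apply: measurable_funM; last exact: measurable_cst.
  by apply: measurable_funM; [exact: measurable_cst|exact: measurable_funX].
have mGx : measurable_fun [set: R] (fun x => (`|y| * window L x * Dp (x, y))%:E).
  by have := @measurable_fun_pair1 _ _ _ _ _ _ _ y (@mf L).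
apply: (@le_trans _ _ (\int[mu]_(x in `[(- (3 / L))%R, (3 / L)%R])
    (`|y| * window L x * Dp (x, y))%:E)%E); last first.
  apply: ge0_subset_integral => //.
  by move=> x _; exact: (@f_ge0 L (x, y)).
apply: ge0_le_integral => //.
- by move=> x /= /inI xI; rewrite -EFinM lee_fin mulr_ge0// fejer_minorant_ge0.
- apply/measurable_EFinP; apply: measurable_funTS.
  apply: measurable_funM; first exact: measurable_cst.
  apply: measurable_funB; first exact: measurable_cst.
  apply: measurable_funM; last exact: measurable_cst.
  by apply: measurable_funM; [exact: measurable_cst|exact: measurable_funX].
- exact: measurable_funTS.
move=> x /= /inI xI; rewrite -EFinM lee_fin mulrAC.
apply: ler_pM => //.
- by rewrite mulr_ge0// fejer_minorant_ge0.
- by rewrite ler_wpM2l// /window le_max lexx orbT.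
- by rewrite tD// (le_lt_trans xI).
Qed.

(** Continuity of [D] at [(0, y)] bounds the lower limit of [G L y] from below by
    [(9/4) |y| Dp (0, y)]. The neighbourhood depends on [y], with no uniformity; Fatou's lemma in
    [y] copes with this. *)
Lemma kac_rice_le (c1 c2 : R) :
  (forall L : R, 0 < L ->
    (\int[P]_w (`|Y w| * window L (X w))%:E <= (c1 + c2 / L)%:E)%E) ->
  (kac_rice D <= (c1 * (4 / 9))%:E)%E.
Proof.
move=> bnd.
pose L (k : nat) : R := k.+1%:R.
have L0 k : 0 < L k by [].
have einf_ge y : (((`|y| * Dp (0, y)) * (9 / 4))%:E <= limn_einf (fun k => G (L k) y))%E.
  apply/lee_addgt0Pr => e e0.
  (* Chosen so that the loss [|y| * (9/4) * e'] is at most [e]; the [+ 1] covers [y = 0]. *)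
  pose e' := e / (`|y| * (9 / 4) + 1).
  have e'0 : 0 < e' by rewrite divr_gt0// ltr_wpDl// mulr_ge0.
  have [del del0 hdel] : exists2 del, 0 < del & forall x, `|x| < del -> Dp (0, y) - e' <= Dp (x, y).
    have /cvgrPdist_lt/(_ _ e'0) := @contD (0, y).
    move=> /nbhs_ballP[del /= del0 h]; exists del => // x xdel.
    have := h (x, y); rewrite /= => /(_ _)/ltW; rewrite ler_distl => hx.
    have /andP[h1 h2] : D x y - e' <= D 0 y <= D x y + e'.
      by apply: hx; split => /=; [rewrite /ball/= sub0r normrN|exact: ballxx].
    rewrite /Dp/= lerBlDr ge_max; apply/andP; split.
      by rewrite addr_ge0 ?le_max ?lexx// ltW.
    by rewrite (le_trans h2)// lerD2r le_max lexx orbT.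
  have [N hN] : exists N, forall k, (N <= k)%N -> 3 / L k < del.
    have [N] : exists N, 0 + N.+1%:R^-1 < del / 3 by apply: ltr_add_invr; rewrite divr_gt0.
    rewrite add0r ltr_pdivlMr// => hN; exists N => k Nk; apply: le_lt_trans hN.
    by rewrite mulrC ler_wpM2r// lef_pV2 ?posrE// ler_nat.
  apply: (@le_trans _ _ ((`|y| * (Dp (0, y) - e') * (9 / 4))%:E + e%:E)%E).
    rewrite -EFinD lee_fin.
    have : `|y| * (9 / 4) * e' <= e.
      rewrite /e' mulrA ler_pdivrMr ?ltr_wpDl ?mulr_ge0// mulrC ler_wpM2l ?(ltW e0)//.
      by rewrite lerDl.
    lra.
  rewrite leeD2r//; apply: (limn_einf_ge_near (N := N)) => k Nk.
  exact: (G_ge (L0 k) (hN k Nk) hdel).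
have key : (\int[mu]_y ((`|y| * Dp (0, y)) * (9 / 4))%:E <= c1%:E)%E.
  apply: (@le_trans _ _ (\int[mu]_y limn_einf (fun k => G (L k) y))%E).
    apply: ge0_le_integral => //.
    - by move=> y _; rewrite lee_fin !mulr_ge0.
    - apply/measurable_EFinP; apply: measurable_funM; last exact: measurable_cst.
      apply: measurable_funM; first exact: measurable_fun_norm.
      by have := @measurable_fun_pair2 _ _ _ _ _ _ _ (0 : R) mDp.
    - apply: measurableT_comp => //; apply: measurable_fun_limn_esup => k.
      by apply: measurableT_comp => //; exact: mG.
  apply: le_trans (fatou mu measurableT (fun k => @mG (L k)) (fun k y _ => G_ge0 (L k) y)) _.
  apply: (limn_einf_le_cvg (w := fun k => (c1 + c2 / L k)%:E)).
    by move=> k; rewrite integral_G bnd.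
  apply: cvg_EFin; first exact: nearW.
  rewrite -[X in _ --> X]addr0; apply: cvgD; first exact: cvg_cst.
  rewrite -(mulr0 c2); apply: cvgMr; exact: cvg_harmonic.
(* The integrand of [kac_rice] may be negative; discarding its negative part leaves [Dp], and
   inserting [4/9 * 9/4] exposes [key]. *)
rewrite /kac_rice integralE.
apply: (@le_trans _ _ (\int[mu]_y ((4 / 9)%:E * ((`|y| * Dp (0, y)) * (9 / 4))%:E))%E).
  rewrite [leRHS](_ : _ = (\int[mu]_(y in [set: R]) (fun y => (`|y| * D 0 y)%:E)^\+ y)%E).
    by rewrite geeDl// oppe_le0; apply: integral_ge0 => y _; exact: funeneg_ge0.
  apply: eq_integral => y _; rewrite funeposE -EFin_max -EFinM; congr EFin.
  have -> : Num.max (`|y| * D 0 y) 0 = `|y| * Num.max 0 (D 0 y).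
    by rewrite maxr_pMr// mulr0 maxC.
  by rewrite /Dp/=; field.
rewrite ge0_integralZl_EFin//.
- by rewrite [c1 * _]mulrC (EFinM (4 / 9) c1) lee_wpmul2l// lee_fin.
- by move=> y _; rewrite lee_fin !mulr_ge0.
- apply/measurable_EFinP; apply: measurable_funM; last exact: measurable_cst.
  apply: measurable_funM; first exact: measurable_fun_norm.
  by have := @measurable_fun_pair2 _ _ _ _ _ _ _ (0 : R) mDp.
Qed.

End kac_rice_fatou.

(** * Constraints on the constants *)

(** Two integrations of [cos_ge1Bsqr], then evenness. It bounds [1 - cos] from below when the second
    moment is recovered from the characteristic function. *)
Lemma cos_le_quartic (R : realType) (x : R) :
  cos x <= 1 - x ^+ 2 / 2 + x ^+ 4 / 24.
Proof.
have sinx (z : R) : 0 <= z -> z - z ^+ 3 / 6 <= sin z.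
  move=> z0; rewrite -subr_ge0.
  have dF (y : R) : is_derive y 1 (fun z => sin z - (z - z ^+ 3 / 6))
      (cos y - (1 - y ^+ 2 / 2)).
    by apply: is_derive_eq; rewrite /GRing.scale/=; field.
  have := le_of_derive_ge0 dF; rewrite sin0 expr0n/= mul0r !subr0; apply => // y _.
  by rewrite subr_ge0 cos_ge1Bsqr.
have pos (z : R) : 0 <= z -> cos z <= 1 - z ^+ 2 / 2 + z ^+ 4 / 24.
  move=> z0; rewrite -subr_ge0.
  have dF (y : R) : is_derive y 1 (fun z => 1 - z ^+ 2 / 2 + z ^+ 4 / 24 - cos z)
      (sin y - (y - y ^+ 3 / 6)).
    by apply: is_derive_eq; rewrite /GRing.scale/=; field.
  have := le_of_derive_ge0 dF; rewrite cos0 !expr0n/= !mul0r subr0 addr0 subrr; apply => // y y0.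
  by rewrite subr_ge0 sinx.
have [/pos//|x0] := leP 0 x.
have -> : x ^+ 2 = (- x) ^+ 2 by ring.
have -> : x ^+ 4 = (- x) ^+ 4 by ring.
by rewrite -cosN pos// oppr_ge0 ltW.
Qed.

Section charfun_constants.
Context d (T : measurableType d) (R : realType) (P : probability T R) (X : {RV P >-> R}).
Hypothesis EX2 : ('E_P[fun w => (X w ^+ 2)%R] = 1%E)%E.

Let iX2 := integrable_sqr_RV EX2.

Let icos s : P.-integrable setT (fun w => (cos (s * X w))%:E).
Proof.
apply: (integrable_le1 P) => [|w]; last exact: normr_cos_le1.
apply: (@measurableT_comp _ _ _ _ _ _ cos); first exact: measurable_cos.
by apply: measurable_funM => //; exact: measurable_cst.
Qed.

Let i1 := finite_measure_integrable_cst P (1 : R) measurableT.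

Let R1 : \int[P]_w (1 : R) = 1.
Proof.
rewrite Rintegral_cst// mul1r [X in fine X](_ : _ = 1%E)//.
exact: probability_setT.
Qed.

Lemma charRe_ge s : 1 - s ^+ 2 / 2 <= charRe P X s.
Proof.
have RX2 : \int[P]_w (X w ^+ 2) = 1.
  by have := EX2; rewrite unlock /Rintegral => ->.
have iX := integrableZr_EFin (s ^+ 2 / 2) measurableT iX2.
have -> : 1 - s ^+ 2 / 2 = \int[P]_w (1 - X w ^+ 2 * (s ^+ 2 / 2)).
  by rewrite RintegralB// RintegralZr// R1 RX2 mul1r.
rewrite charReE; apply: le_Rintegral => //.
- by have := integrableB measurableT i1 iX; apply: eq_integrable.
- exact: icos.
move=> w _; apply: le_trans (cos_ge1Bsqr _).
by rewrite exprMn mulrA [_ * s ^+ 2]mulrC.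
Qed.

(** Second-order comparison at 0: unit variance gives [1 - s^2 / 2] from below, the decay with
    Bernoulli gives [1 / (1 + a q s^2)] from above. *)
Lemma charfun_decay_le_half (a q : R) : 0 < a -> 1 <= q ->
  (forall s : R, cmod (charRe P X s) (charIm P X s) <= 1 / (1 + a * s ^+ 2) `^ q) ->
  a * q <= 1 / 2.
Proof.
move=> a0 q1 char_le; rewrite leNgt; apply/negP => h.
have aq0 : 0 < a * q by lra.
(* With [p = a q] and [t = s^2], the two bounds force [t (p - 1/2) - p t^2 / 2 <= 0]. This [t]
   maximizes the left side, which is positive there when [p > 1/2]. *)
pose t := (a * q - 1 / 2) / (a * q).
have t0 : 0 < t by rewrite divr_gt0// subr_gt0.
have tE : a * q * t = a * q - 1 / 2 by rewrite /t mulrC divfK// gt_eqF.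
have s2 : Num.sqrt t ^+ 2 = t by rewrite sqr_sqrtr// ltW.
have h1 := charRe_ge (Num.sqrt t); rewrite s2 in h1.
have h2 : charRe P X (Num.sqrt t) <= 1 / (1 + a * q * t).
  apply: (@le_trans _ _ (cmod (charRe P X (Num.sqrt t)) (charIm P X (Num.sqrt t)))).
    apply: le_trans (ler_norm _) _; rewrite -sqrtr_sqr /cmod ler_wsqrtr//.
    by rewrite lerDl sqr_ge0.
  apply: le_trans (char_le _) _; rewrite s2 !div1r lef_pV2 ?posrE.
  - apply: le_trans (powR_bernoulli _ q1); last by rewrite mulr_ge0// ltW.
    by rewrite mulrA [q * a]mulrC.
  - by apply: powR_gt0; rewrite ltr_pwDl// mulr_ge0// ltW.
  - by rewrite ltr_pwDl// mulr_ge0// ltW.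
have := le_trans h1 h2; rewrite ler_pdivlMr; last by rewrite ltr_pwDl// mulr_ge0// ltW.
rewrite tE; nra.
Qed.

(** The bound on the second derivative gives [1 - f s <= C2 s^2 / 2], and [2 L^2 (1 - cos (X / L))]
    tends to [X^2]. Fatou's lemma then yields [E[X^2] <= C2] without differentiating under the
    expectation. *)
Lemma charRe_derive2_ge1 (C2 : R) :
  (forall s : R, derivable (charRe P X) s 1) ->
  (forall s : R, derivable (derive1 (charRe P X)) s 1) ->
  (forall s : R, - C2 <= derive1n 2 (charRe P X) s) -> 1 <= C2.
Proof.
move=> d1 d2 C2_le.
set f := charRe P X in d1 d2 C2_le.
have dd1 (s : R) : is_derive s 1 f (derive1 f s).
  by rewrite derive1E; exact: derivableP.
have dd2 (s : R) : is_derive s 1 (derive1 f) (derive1n 2 f s).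
  by rewrite [derive1n 2 f s]derive1E; exact: derivableP.
move: (derive1n 2 f) C2_le dd2 => f2 C2_le dd2.
(* Symmetrizing makes the first derivative vanish at 0 without computing [derive1 f 0]. *)
pose F s := f s + f (- s) + C2 * s ^+ 2.
pose F1 s := derive1 f s - derive1 f (- s) + 2 * C2 * s.
have dcomp (g g' : R -> R) (s : R) : (forall s : R, is_derive s 1 g (g' s)) ->
    is_derive s 1 (fun s => g (- s)) (- g' (- s)).
  move=> dg; have := @is_derive1_comp R g -%R s (g' (- s)) (-1) (dg _) (is_deriveNid _ _).
  by rewrite mulrN1.
have dF (s : R) : is_derive s 1 F (F1 s).
  have := dcomp _ _ s dd1 => ?.
  by apply: is_derive_eq; rewrite /F1 /GRing.scale/=; ring.
have dF1 (s : R) : is_derive s 1 F1 (f2 s + f2 (- s) + 2 * C2).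
  have := dcomp _ _ s dd2 => ?.
  by apply: is_derive_eq; rewrite /GRing.scale/=; ring.
have F1_ge0 s : 0 <= s -> 0 <= F1 s.
  move=> s0; have := le_of_derive_ge0 dF1 _ s0.
  rewrite /F1 oppr0 subrr mulr0 addr0; apply => z _.
  by have := C2_le z; have := C2_le (- z); lra.
have feven s : f (- s) = f s.
  by rewrite /f !charReE; apply: eq_Rintegral => w _; rewrite mulNr cosN.
have f0 : f 0 = 1.
  by rewrite /f charReE -[RHS]R1; apply: eq_Rintegral => w _; rewrite mul0r cos0.
have F_le s : 0 <= s -> 1 - f s <= C2 * s ^+ 2 / 2.
  move=> s0; have := le_of_derive_ge0 dF F1_ge0 s0.
  rewrite /F oppr0 !feven f0 expr0n/= mulr0; lra.
pose L (k : nat) : R := k.+1%:R.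
have L0 k : 0 < L k by [].
pose g (k : nat) (w : T) : \bar R := ((1 - cos ((L k)^-1 * X w)) * (2 * L k ^+ 2))%:E.
have mg k : measurable_fun [set: T] (g k).
  apply/measurable_EFinP; apply: measurable_funM; last exact: measurable_cst.
  apply: measurable_funB; first exact: measurable_cst.
  by have /measurable_int/measurable_EFinP := icos (L k)^-1.
have g0 k w : (0 <= g k w)%E.
  by rewrite lee_fin mulr_ge0 ?subr_ge0 ?cos_le1// mulr_ge0// sqr_ge0.
rewrite -lee_fin; have := EX2; rewrite unlock => <-.
apply: (@le_trans _ _ (\int[P]_w limn_einf (fun k => g k w))%E).
  apply: ge0_le_integral => //.
  - by move=> w _; rewrite lee_fin sqr_ge0.
  - by have /measurable_int := iX2.
  - apply: measurableT_comp => //; apply: measurable_fun_limn_esup => k.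
    exact: measurableT_comp.
  move=> w _; apply/lee_addgt0Pr => e e0.
  rewrite -leeBlDr// -EFinB.
  have [N] : exists N, 0 + N.+1%:R^-1 < e / (X w ^+ 4 + 1).
    by apply: ltr_add_invr; rewrite divr_gt0// ltr_wpDl// exprn_even_ge0.
  rewrite add0r ltr_pdivlMr ?ltr_wpDl ?exprn_even_ge0// => hN.
  apply: (limn_einf_ge_near (N := N)) => k Nk; rewrite lee_fin.
  have := cos_le_quartic ((L k)^-1 * X w).
  have lk : (L k)^-1 <= N.+1%:R^-1 by rewrite lef_pV2 ?posrE// ler_nat.
  have li : L k * (L k)^-1 = 1 by rewrite mulfV// gt_eqF.
  have l0 : 0 < (L k)^-1 by rewrite invr_gt0.
  have l1 : (L k)^-1 <= 1 by rewrite invf_le1// ler1n.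
  move: hN lk li l0 l1 (L0 k) e0; rewrite !exprMn.
  move: (N.+1%:R^-1) (L k) ((L k)^-1) (X w) (cos _) => i l j y c hN ij lj j0 j1 l0 e0 hc.
  have lj2 : l ^+ 2 * j ^+ 2 = 1 by rewrite -exprMn lj expr1n.
  (* The quartic error is made small for each fixed outcome, with [N] depending on [X w], so only
     pointwise values of [X ^+ 4] occur. *)
  have y4 : 0 <= y ^+ 4 by rewrite exprn_even_ge0.
  have : (j ^+ 2 * y ^+ 2 / 2 - j ^+ 4 * y ^+ 4 / 24) * (2 * l ^+ 2) <= (1 - c) * (2 * l ^+ 2).
    by rewrite ler_wpM2r ?mulr_ge0 ?sqr_ge0//; lra.
  have -> : (j ^+ 2 * y ^+ 2 / 2 - j ^+ 4 * y ^+ 4 / 24) * (2 * l ^+ 2) =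
      (l ^+ 2 * j ^+ 2) * (y ^+ 2 - j ^+ 2 * y ^+ 4 / 12) by field.
  rewrite lj2 mul1r.
  have : j ^+ 2 * y ^+ 4 <= i * (y ^+ 4 + 1).
    apply: (@le_trans _ _ (i * y ^+ 4)); last by rewrite mulrDr mulr1 lerDl; lra.
    rewrite ler_wpM2r// expr2; apply: le_trans ij; rewrite ler_piMl//; lra.
  have : 0 <= j ^+ 2 * y ^+ 4 by rewrite mulr_ge0// sqr_ge0.
  lra.
apply: le_trans (fatou P measurableT mg (fun k w _ => g0 k w)) _.
apply: (limn_einf_le_cvg (w := fun=> C2%:E)); last exact: cvg_cst.
move=> k; have lk0 : 0 <= (L k)^-1 by rewrite invr_ge0 ltW.
have ig : P.-integrable setT (fun w => (1 - cos ((L k)^-1 * X w))%:E).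
  by have := integrableB measurableT i1 (icos (L k)^-1); apply: eq_integrable.
have -> : (\int[P]_w g k w = (\int[P]_w ((1 - cos ((L k)^-1 * X w)) * (2 * L k ^+ 2)))%:E)%E.
  by rewrite /Rintegral fineK//; apply: integrable_fin_num => //; exact: integrableZr_EFin.
have Ef : \int[P]_w (1 - cos ((L k)^-1 * X w)) = 1 - f (L k)^-1.
  rewrite RintegralB//; last exact: icos.
  by rewrite /f charReE; congr (_ - _); exact: R1.
rewrite lee_fin RintegralZr// Ef.
have := F_le _ lk0.
have li : (L k)^-1 ^+ 2 * (L k ^+ 2) = 1 by rewrite -exprMn mulVf ?expr1n// gt_eqF.
move=> h; have := ler_wpM2r (_ : 0 <= 2 * L k ^+ 2) h; rewrite mulr_ge0 ?sqr_ge0// => /(_ isT).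
have -> : C2 * (L k)^-1 ^+ 2 / 2 * (2 * L k ^+ 2) = C2 * ((L k)^-1 ^+ 2 * (L k ^+ 2)) by field.
by rewrite li mulr1.
Qed.

End charfun_constants.

Unset Implicit Arguments.

Theorem theorem2 (R : realType) (n : nat) (f : 'I_n.+1 -> R -> R)
  (d : measure_display) (T : measurableType d) (P : probability T R)
  (eta : 'I_n.+1 -> {RV P >-> R}) (a q C2 C3 : R) (x : R) (D : R -> R -> R) :
  (1 <= n)%N ->
  (forall k, entire_real (f k)) ->
  mutually_independent P (fun k => (eta k : T -> R)) ->
  identically_distributed P (fun k => (eta k : T -> R)) ->
  (forall k, 'E_P[eta k] = 0%E)%E ->
  (forall k, 'E_P[fun w => (eta k w ^+ 2)%R] = 1%E)%E ->
  0 < a -> 1 <= q ->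
  (forall s : R, cmod (charRe P (eta ord0) s) (charIm P (eta ord0) s)
                   <= 1 / (1 + a * s ^+ 2) `^ q) ->
  (forall s : R, derivable (charRe P (eta ord0)) s 1) ->
  (forall s : R, derivable (derive1 (charRe P (eta ord0))) s 1) ->
  (forall s : R, derivable (derive1n 2 (charRe P (eta ord0))) s 1) ->
  (forall s : R, derivable (charIm P (eta ord0)) s 1) ->
  (forall s : R, derivable (derive1 (charIm P (eta ord0))) s 1) ->
  (forall s : R, derivable (derive1n 2 (charIm P (eta ord0))) s 1) ->
  0 < C2 -> 0 < C3 ->
  (forall s : R, cmod (derive1n 2 (charRe P (eta ord0)) s) (derive1n 2 (charIm P (eta ord0)) s) <= C2) ->
  (forall s : R, cmod (derive1n 3 (charRe P (eta ord0)) s) (derive1n 3 (charIm P (eta ord0)) s) <= C3) ->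
  0 < Kn f x ->
  0 < Kn11 f x * Kn f x - Kn01 f x ^+ 2 ->
  is_joint_density P (Pn eta f x) (dPn eta f x) D ->
  continuous (fun p : R * R => D p.1 p.2) ->
  (kac_rice D <=
     (Kcal f x * (1 / (a * q)) *
       (k1 R + C3 * k2 R + 1 / Num.sqrt (a * q) * C2 * (k3 R + C2 * k4 R)))%:E)%E.
Proof.
move=> _ _ indep iid EX EX2 a0 q1 char_le dR1 dR2 _ _ _ _ C20 C30 C2_le _ K0 D0 dens cont.
set u := fun k => f k x; set v := fun k => derive1 (f k) x.
have PnE : Pn eta f x = partial_sum eta u [set: 'I_n.+1]%SET.
  by apply/funext => w; apply: eq_bigl => i; rewrite inE.
have dPnE : dPn eta f x = partial_sum eta v [set: 'I_n.+1]%SET.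
  by apply/funext => w; apply: eq_bigl => i; rewrite inE.
have mS (c : 'I_n.+1 -> R) :
    measurable_fun [set: T] (partial_sum eta c [set: 'I_n.+1]%SET).
  by apply: (@measurable_wrt_measurable _ _ _ P _ eta [set: 'I_n.+1]%SET);
     exact: measurable_wrt_sum.
rewrite PnE dPnE in dens.
have NE : \sum_k u k * v k = Kn01 f x by [].
have D0' : 0 < (\sum_k v k ^+ 2) * (\sum_k u k ^+ 2) - (\sum_k u k * v k) ^+ 2 by [].
have aq0 : 0 < a * q by rewrite mulr_gt0// (lt_le_trans _ q1).
set b := 1 / Num.sqrt (a * q).
have b0 : 0 < b by rewrite divr_gt0// sqrtr_gt0.
have bE : b ^+ 2 = 1 / (a * q) by rewrite /b expr_div_n sqr_sqrtr ?ltW// expr1n.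
have aq_half := charfun_decay_le_half (EX2 ord0) a0 q1 char_le.
have b2 : 2 <= b ^+ 2 by rewrite bE ler_pdivlMr//; lra.
have C21 : 1 <= C2.
  apply: (charRe_derive2_ge1 (EX2 ord0) dR1 dR2) => s.
  have : `|derive1n 2 (charRe P (eta ord0)) s| <= C2.
    apply: le_trans (C2_le s); rewrite -sqrtr_sqr /cmod ler_wsqrtr//.
    by rewrite lerDl sqr_ge0.
  by rewrite ler_norml => /andP[].
(* The shape [c1 + c2 / L] asked for by [kac_rice_le]. After the factor [4 / 9], [c1] becomes
   [Kcal f x] times the left side of [constant_bound]. *)
have bound (L : R) : 0 < L ->
    (\int[P]_w (`|partial_sum eta v [set: 'I_n.+1]%SET w| *
       window L (partial_sum eta u [set: 'I_n.+1]%SET w))%:E <=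
     ((1 + Num.sqrt 3) * Kcal f x * (pi / 2 * b) +
      (`|Kn01 f x / Kn f x| * 4 / Num.sqrt (Kn f x) * (pi / 2 * b)) / L)%:E)%E.
  move=> L0.
  apply: le_trans (window_moment_le indep iid EX EX2 a0 q1 char_le K0 D0' L0) _.
  rewrite lee_fin NE -/(Kn f x) -/(Kn11 f x) -/(Kcal f x) le_eqVlt; apply/orP; left.
  apply/eqP; rewrite /b; field.
  by rewrite !gt_eqF// sqrtr_gt0.
apply: le_trans (kac_rice_le (mS u) (mS v) dens cont bound) _.
rewrite lee_fin -bE -mulrA.
have Kcal0 : 0 <= Kcal f x by rewrite divr_ge0 ?sqrtr_ge0// ltW.
have := ler_wpM2l Kcal0 (constant_bound b0 b2 C21 C30).
lra.
Qed.
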